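(* Let $\Delta$ be a connected, orientable $\mathbf{k}$-homology manifold with boundary and let $\Theta$ be a generic linear system of parameters for $\mathbf{k}[\hat{\Delta}]$, where $\hat\Delta$ is the completion of $\Delta$. Then the ring $\overline{\mathbf{k}(\hat{\Delta},\Theta)}$ is Gorenstein.
   Context: Fix an infinite field $\mathbf{k}$; all homology is with coefficients in $\mathbf{k}$. For a face $F$ of a simplicial complex $\Delta$, $\mathrm{lk}_\Delta F=\{G\in\Delta: G\cap F=\emptyset,\ G\cup F\in\Delta\}$; a proper link is the link of a nonempty face. A pure $(d-1)$-dimensional simplicial complex $\Delta$ is a $\mathbf{k}$-homology manifold without boundary ($\partial\Delta=\emptyset$) if every proper link $\mathrm{lk}_\Delta F$ has the $\mathbf{k}$-homology of a $(d-1-|F|)$-dimensional sphere. It is a $\mathbf{k}$-homology manifold with boundary if every proper link $\mathrm{lk}_\Delta F$ has the $\mathbf{k}$-homology of a $(d-1-|F|)$-dimensional sphere or ball, and the boundary complex $\partial\Delta:=\{F\in\Delta:\tilde H_*(\mathrm{lk}_\Delta F;\mathbf{k})=0\}\cup\{\emptyset\}$ is a $(d-2)$-dimensional $\mathbf{k}$-homology manifold without boundary. A connected $\Delta$ is orientable if the top homology of the pair $(\Delta,\partial\Delta)$ is $1$-dimensional. With $v_0$ a new vertex, the completion of $\Delta$ is $\hat\Delta:=\Delta\cup(v_0*\partial\Delta)$, where $v_0*\Gamma=\Gamma\cup\{\{v_0\}\cup F: F\in\Gamma\}$ is the cone. For a $(d-1)$-dimensional complex $\Gamma$ on vertex set $V$,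 let $A=\mathbf{k}[x_v:v\in V]$, $\mathfrak m=(x_v : v\in V)$, and let $\mathbf{k}[\Gamma]=A/I_\Gamma$ be the Stanley--Reisner ring, $I_\Gamma=(\prod_{v\in F}x_v: F\subseteq V, F\notin\Gamma)$. A linear system of parameters (l.s.o.p.) is a sequence $\Theta=\theta_1,\dots,\theta_d$ of linear forms such that $\mathbf{k}(\Gamma,\Theta):=\mathbf{k}[\Gamma]/\Theta\mathbf{k}[\Gamma]$ is finite-dimensional over $\mathbf{k}$. ''Generic'' means that the coefficients lie in a suitable nonempty Zariski-open set. The socle of a graded $A$-module $M$ is $\mathrm{Soc}\,M=\{\nu\in M:\mathfrak m\nu=0\}$; for a finite-dimensional standard graded algebra $M=A/I$, the interior socle is $\mathrm{Soc}^\circ M=\bigoplus_{i=0}^{d_0-1}(\mathrm{Soc}\,M)_i$, $d_0=\max\{j:M_j\ne0\}$. Put $\overline{\mathbf{k}(\Gamma,\Theta)}:=\mathbf{k}(\Gamma,\Theta)/\mathrm{Soc}^\circ\,\mathbf{k}(\Gamma,\Theta)$. A finite-dimensional standard graded algebra $A/I$ is Gorenstein if its socle is $1$-dimensional over $\mathbf{k}$. *)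

(* Defs.v *)
From HB Require Import structures.
From mathcomp Require Import all_boot all_algebra.
From mathcomp Require Export mpoly.

Set Implicit Arguments.
Unset Strict Implicit.
Unset Printing Implicit Defensive.

Import GRing.Theory.
Local Open Scope ring_scope.

Definition infinite_field (k : fieldType) : Prop :=
  forall s : seq k, exists x : k, x \notin s.

(** * Simplicial complexes with vertices in ['I_n]

    A complex is its set of faces, including the empty face.  Elements of
    ['I_n] that are not vertices of the complex are allowed, so that links
    and boundaries live over the same ['I_n]. *)

Section Complexes.
Variable n : nat.
Implicit Types (Gamma Delta : {set {set 'I_n}}) (F G : {set 'I_n}).

Definition simplicial_complex Gamma : Prop :=
  set0 \in Gamma /\
  forall F G, F \in Gamma -> G \subset F -> G \in Gamma.

(** Pure of dimension [d - 1]. *)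
Definition pure_complex (d : nat) Gamma : Prop :=
  forall F, maxset [pred G | G \in Gamma] F -> #|F| = d.

Definition link Delta F : {set {set 'I_n}} :=
  [set G in Delta | [disjoint G & F] & G :|: F \in Delta].

(** Any two vertices are joined by a path of edges. *)
Definition connected_complex Delta : Prop :=
  forall u v : 'I_n, [set u] \in Delta -> [set v] \in Delta ->
    connect (fun x y => [set x; y] \in Delta) u v.

(** * Simplicial homology

    Everything is indexed by the cardinality [j] of faces: the index [j]
    stands for the homological degree [j - 1], and the augmentation (degree
    [-1]) is the index [0]. *)

Variable k : fieldType.

Definition chain_space : vectType k := {ffun {set 'I_n} -> k^o}.

Definition face_chain F : chain_space := [ffun G => (G == F)%:R].

(** Faces are oriented by the order of ['I_n]. *)
Definition boundary_face F : chain_space :=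
  \sum_(v in F)
     (-1) ^+ #|[set u in F | (u < v)%N]| *: face_chain (F :\ v).

Definition boundary_fun (c : chain_space) : chain_space :=
  \sum_F (c : {ffun {set 'I_n} -> k^o}) F *: boundary_face F.

Lemma boundary_fun_is_linear : linear boundary_fun.
Proof.
move=> a x y; rewrite /boundary_fun scaler_sumr -big_split /=.
by apply: eq_bigr => F _; rewrite !ffunE scalerDl scalerA.
Qed.

HB.instance Definition _ :=
  GRing.isLinear.Build k chain_space chain_space _ boundary_fun
    boundary_fun_is_linear.

Definition boundary_map : 'End(chain_space) := linfun boundary_fun.

Definition chains Gamma (j : nat) : {vspace chain_space} :=
  <<[seq face_chain F | F <- enum Gamma & #|F| == j]>>%VS.

(** The relative chain complex is the quotient of the chains of [Delta] by
    those of [Gamma]; cycles and boundaries are taken as their preimages in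
    the chains of [Delta]. *)
Definition rel_cycles Delta Gamma (j : nat) : {vspace chain_space} :=
  (chains Delta j :&: boundary_map @^-1: chains Gamma j.-1)%VS.

Definition rel_boundaries Delta Gamma (j : nat) : {vspace chain_space} :=
  (boundary_map @: chains Delta j.+1 + chains Gamma j)%VS.

(** [\dim_k H_(j-1)(Delta, Gamma)], for a subcomplex [Gamma] of [Delta]. *)
Definition rel_betti Delta Gamma (j : nat) : nat :=
  (\dim (rel_cycles Delta Gamma j) - \dim (rel_boundaries Delta Gamma j))%N.

(** [\dim_k] of the reduced homology of [Delta] in degree [j - 1]: relative
    to the void complex (not even the empty face), the augmented chain complex
    of [Delta] is left unchanged. *)
Definition red_betti Delta (j : nat) : nat := rel_betti Delta set0 j.

(** The homology of a sphere of dimension [e - 1]. *)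
Definition sphere_homology (e : nat) Gamma : Prop :=
  forall j, red_betti Gamma j = (j == e).

(** The homology of a ball.  No face has more than [n] elements, so this
    covers all degrees. *)
Definition acyclic Gamma : bool :=
  [forall j : 'I_n.+1, red_betti Gamma j == 0%N].

(** * Homology manifolds of dimension [d - 1] *)

Definition homology_manifold (d : nat) Delta : Prop :=
  [/\ simplicial_complex Delta, pure_complex d Delta
    & forall F, F \in Delta -> F != set0 ->
        sphere_homology (d - #|F|) (link Delta F)].

Definition boundary_complex Delta : {set {set 'I_n}} :=
  [set F in Delta | acyclic (link Delta F)] :|: [set set0].

Definition homology_manifold_with_boundary (d : nat) Delta : Prop :=
  [/\ simplicial_complex Delta, pure_complex d Delta,
      forall F, F \in Delta -> F != set0 ->
        sphere_homology (d - #|F|) (link Delta F) \/ acyclic (link Delta F),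
      (0 < d)%N
    & homology_manifold d.-1 (boundary_complex Delta)].

Definition orientable (d : nat) Delta : Prop :=
  rel_betti Delta (boundary_complex Delta) d = 1%N.

(** The vertex [i] of [Delta] becomes [lift ord0 i], and the new vertex
    [v_0] is [ord0]. *)
Definition completion Delta : {set {set 'I_n.+1}} :=
  [set lift ord0 @: F | F : {set 'I_n} in Delta] :|:
  [set ord0 |: (lift ord0 @: F) | F : {set 'I_n} in boundary_complex Delta].

End Complexes.

(** * Graded quotients of the polynomial ring

    A graded algebra [A / I], [A = k[x_0, ..., x_(n-1)]], is given by its
    ideal [I], and a submodule of [A / I] by its preimage in [A]. *)

Section Algebras.
Variables (k : fieldType) (n : nat).
Local Notation A := {mpoly k[n]}.
Implicit Types (I : A -> Prop) (f g : A).

Definition ideal_gen (s : seq A) (f : A) : Prop :=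
  exists c : 'I_(size s) -> A, f = \sum_(i < size s) c i * s`_i.

Definition max_ideal : A -> Prop := ideal_gen [seq 'X_i | i <- enum 'I_n].

Definition finite_dim_quotient I : Prop :=
  exists s : seq A, forall f, exists c : 'I_(size s) -> k,
    I (f - \sum_(i < size s) c i *: s`_i).

(** [Soc (A / I)] *)
Definition socle I f : Prop := forall g, max_ideal g -> I (g * f).

(** [(A / I)_j != 0] *)
Definition graded_piece_neq0 I (j : nat) : Prop :=
  exists f, f \is j.-homog /\ ~ I f.

(** [d0 = max {j | (A / I)_j != 0}] *)
Definition top_degree I (d0 : nat) : Prop :=
  graded_piece_neq0 I d0 /\
  forall j, graded_piece_neq0 I j -> (j <= d0)%N.

(** The ideal [J] of [A] such that [J / I] is the interior socle
    [\bigoplus_(i < d0) (Soc (A / I))_i], so that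
    [A / J = (A / I) / Soc^o (A / I)]. *)
Definition interior_socle I f : Prop :=
  exists d0, top_degree I d0 /\
  exists g : 'I_d0 -> A,
    (forall i : 'I_d0, g i \is i.-homog /\ socle I (g i)) /\
    I (f - \sum_(i < d0) g i).

(** [A / I] is finite-dimensional and its socle is one-dimensional. *)
Definition gorenstein I : Prop :=
  finite_dim_quotient I /\
  exists s, [/\ socle I s, ~ I s
              & forall f, socle I f -> exists c : k, I (f - c *: s)].

(** The linear form with coefficients the [i]-th row of [Theta]. *)
Definition linear_form (d : nat) (Theta : 'M[k]_(d, n)) (i : 'I_d) : A :=
  \sum_(j < n) Theta i j *: 'X_j.

Definition nonface_monomials (Gamma : {set {set 'I_n}}) : seq A :=
  [seq \prod_(v in F) 'X_v | F : {set 'I_n} <- enum (~: Gamma)].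

(** [I_Gamma + (Theta)], so that
    [A / face_ideal Gamma Theta = k[Gamma] / Theta k[Gamma]]. *)
Definition face_ideal (Gamma : {set {set 'I_n}}) (d : nat)
    (Theta : 'M[k]_(d, n)) : A -> Prop :=
  ideal_gen (nonface_monomials Gamma ++
             [seq linear_form Theta i | i <- enum 'I_d]).

(** For [Gamma] of dimension [d - 1]. *)
Definition is_lsop (Gamma : {set {set 'I_n}}) (d : nat)
    (Theta : 'M[k]_(d, n)) : Prop :=
  finite_dim_quotient (face_ideal Gamma Theta).

End Algebras.

(** * Genericity *)

Section Generic.
Variables (k : fieldType) (d n : nat).

Definition zariski_open (U : 'M[k]_(d, n) -> Prop) : Prop :=
  exists s : seq {mpoly k[d * n]}, forall Theta,
    U Theta <-> exists2 p, p \in s & p.@[mxvec Theta 0] != 0.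

Definition generic (P : 'M[k]_(d, n) -> Prop) : Prop :=
  exists U : 'M[k]_(d, n) -> Prop,
    [/\ zariski_open U, exists Theta, U Theta
      & forall Theta, U Theta -> P Theta].

End Generic.

(* Main.v *)
From HB Require Import structures.
Require Import Defs.
From mathcomp Require Import all_boot all_algebra.
From mathcomp Require Import zify ring.
Set Implicit Arguments.
Unset Strict Implicit.
Unset Printing Implicit Defensive.
Import GRing.Theory.
Local Open Scope ring_scope.

(** Write [Gamma] for the completion, [d] for the size of its facets, [A] for
    its face ring modulo the forms [theta_0, ..., theta_(d-1)], and [lk] for
    links.  The interior socle of [A] turns out to be the annihilator, below
    degree [d], of a degree map, and the quotient of an algebra by such an
    annihilator has a one-dimensional socle.

    The degree map [deg] is a linear functional on the forms of degree [d]
    that vanishes on the ideal of [A].  A top cycle [z] of [Gamma] gives one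
    ([degree_istar]): attach to each facet [F] the point [p_F] supported on [F]
    where all forms vanish but the last, which is [1], and sum the values at
    these points with suitable weights.  On the monomial of a facet [F] the
    functional is [z F] divided by the minor of the forms on [F].  Orientability
    gives a unique [z] up to scalars ([exists_cycle_cone], [coh_le1_cone_rel]),
    so that [A] is one-dimensional in degree [d] ([star_dual_top]), and
    connectedness makes [z] nonzero on each facet that contains a vertex of
    [Delta] ([completion_cycle_neq0]).

    Let [f] have degree [i < d] and [deg (f * b) = 0] for all [b].  For a vertex
    [v] of [Delta] then [deg ('X_v * f * b) = 0] for all [b], and
    [(f, b) |-> deg ('X_v * f * b)] is a pairing on the face ring of the star of
    [v] modulo the forms.  All links of faces containing [v] have the homology
    of spheres, also at the boundary of [Delta], where the new vertex cones off
    the boundary of an acyclic link ([completion_link_coh_zero]).  For such stars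
    the pairing is perfect ([star_dual]), so [f] vanishes in the star of [v], and
    ['X_v * f = 0] in [A].  The variable of the new vertex, whose link need not
    be a sphere, is a combination of the other variables modulo [theta_0].
    Hence [f] lies in the socle.  Conversely a socle element below degree [d] is
    orthogonal to everything, as its multiples of degree [d] vanish
    ([interior_socle_gorenstein]).

    The pairing is perfect by downward induction on the face [G] whose star is
    considered.  An element orthogonal to everything vanishes in the stars of
    all larger faces by induction.  The star rings of the faces [G :|: H], for
    [H] in the link of [G], form a Cech complex.  Once the
    variables of [G] are eliminated, the part of this complex at a monomial is
    the cochain complex of a cone, or, for the constant monomial, of the link of
    [G]; so there is cohomology only in top cochain degree.  Dividing out the
    remaining forms one by one moves this class along an antidiagonal
    ([cech_exact_big]), which reaches the kernel of the first map only in the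
    top degree [d - #|G|].  The induction also shows that the
    forms are a regular sequence on the star rings ([star_regular]).

    The forms are generic in the sense that for every [r <= d] the minors of the
    first [r] forms on all sets of [r] vertices are nonzero.  The initial forms
    can then be solved for the variables of any face ([exists_elimination]),
    and this keeps monomial arguments available after dividing them out. *)

(** * Coboundaries twisted by a linear form *)

Section Coboundary.
Variables (R : comNzRingType) (N : nat).
Implicit Types (F G H : {set 'I_N}) (u v w : 'I_N) (a b : 'I_N -> R).

(** The sign of [v] in the boundary of the oriented face [F]. *)
Definition sgn v F : R := (-1) ^+ #|[set u in F | (u < v)%N]|.

Lemma sgn_sq v F : sgn v F * sgn v F = 1.
Proof. by rewrite -expr2 sqrr_sign. Qed.

Lemma sgnU v G H : [disjoint G & H] -> sgn v (G :|: H) = sgn v G * sgn v H.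
Proof.
move=> dGH; rewrite /sgn -exprD; congr (_ ^+ _).
rewrite -cardsUI [X in (_ + #|pred_of_set X|)%N](_ : _ = set0) ?cards0 ?addn0.
  by apply: eq_card => u; rewrite !inE andb_orl.
apply/setP => u; rewrite !inE; case: (boolP (u \in G)) => //= uG.
by rewrite (disjointFr dGH uG) andbF.
Qed.

Lemma sgn_set1 u v : sgn u [set v] = if (v < u)%N then -1 else 1.
Proof.
rewrite /sgn; case: ifP => vu.
  rewrite (_ : [set _ in _ | _] = [set v]) ?cards1 ?expr1 //.
  by apply/setP => x; rewrite !inE; case: eqP => // ->.
rewrite (_ : [set _ in _ | _] = set0) ?cards0 ?expr0 //.
by apply/setP => x; rewrite !inE; case: eqP => // ->.
Qed.

Lemma sgnU1 u v F : v \notin F -> sgn u (v |: F) = sgn u [set v] * sgn u F.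
Proof. by move=> vF; rewrite sgnU // disjoints1. Qed.

Lemma sgnD1 u v F : v \in F -> sgn u F = sgn u [set v] * sgn u (F :\ v).
Proof. by move=> vF; rewrite -sgnU1 ?setD1K // setD11. Qed.

Lemma sgn_swap v w F : v \in F -> w \in F -> v != w ->
  sgn v F * sgn w (F :\ v) = - (sgn w F * sgn v (F :\ w)).
Proof.
move=> vF wF nvw; rewrite (sgnD1 v wF) (sgnD1 w vF) !sgn_set1.
have : nat_of_ord v != w by [].
case: ltngtP => //= _ _; rewrite !(mulN1r, mul1r) ?mulNr ?opprK mulrC //.
Qed.

Variable V : lmodType R.
Implicit Types f g : {set 'I_N} -> V.

(** The exterior product of the form [a] with the cochain [f]; for [a = 1] this
    is the simplicial coboundary. *)
Definition cobd a f F : V := \sum_(v in F) (sgn v F * a v) *: f (F :\ v).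

Lemma eq_cobd a f g F : (forall v, v \in F -> f (F :\ v) = g (F :\ v)) ->
  cobd a f F = cobd a g F.
Proof. by move=> fg; apply: eq_bigr => v vF; rewrite fg. Qed.

Lemma cobd_cobdE a b f F :
  cobd a (cobd b f) F = \sum_v \sum_w
    if [&& v \in F, w \in F & v != w]
    then (sgn v F * sgn w (F :\ v) * (a v * b w)) *: f (F :\ v :\ w) else 0.
Proof.
rewrite /cobd big_mkcond; apply: eq_bigr => v _ /=.
case: ifP => vF; last by rewrite big1.
rewrite scaler_sumr big_mkcond; apply: eq_bigr => w _ /=.
rewrite !inE andbC eq_sym; case: ifP => // _; rewrite scalerA.
by congr (_ *: _); rewrite mulrACA.
Qed.

Lemma sum_antisym (g : 'I_N -> 'I_N -> V) :
  (forall v, g v v = 0) -> (forall v w, v != w -> g v w = - g w v) ->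
  \sum_v \sum_w g v w = 0.
Proof.
move=> g0 ga.
have E v : \sum_w g v w = \sum_(w : 'I_N | (w < v)%N) g v w
    + \sum_(w : 'I_N | (v < w)%N) g v w.
  rewrite (bigID (fun w : 'I_N => (w < v)%N)) /=; congr (_ + _).
  rewrite (bigID (fun w : 'I_N => (v < w)%N)) /= [X in _ + X]big1 ?addr0.
    by apply: eq_bigl => w; case: ltngtP.
  move=> w; case: ltngtP => // /val_inj -> _; exact: g0.
rewrite (eq_bigr _ (fun v _ => E v)) big_split /=.
rewrite [X in _ + X](exchange_big_dep xpredT) //= -big_split /= big1 // => v _.
rewrite -big_split /= big1 // => w wv; rewrite (ga v) ?addNr //.
by apply: contraTneq wv => ->; rewrite ltnn.
Qed.

(** The terms of [(v, w)] and [(w, v)] cancel, hence this holds in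
    characteristic two as well. *)
Lemma cobd_sq a f F : cobd a (cobd a f) F = 0.
Proof.
rewrite cobd_cobdE; apply: sum_antisym => [v|v w nvw]; first by rewrite eqxx !andbF.
rewrite (eq_sym w) nvw !andbT (andbC (w \in F)); case: ifP; last by rewrite oppr0.
case/andP=> vF wF; rewrite (sgn_swap vF wF) // mulNr scaleNr; congr (- (_ *: _)).
  by rewrite (mulrC (a v)).
by congr f; apply/setP => x; rewrite !inE andbCA.
Qed.

Lemma cobd_anti a b f F : cobd a (cobd b f) F = - cobd b (cobd a f) F.
Proof.
rewrite !cobd_cobdE [in RHS]exchange_big /= -sumrN; apply: eq_bigr => v _.
rewrite -sumrN; apply: eq_bigr => w _.
rewrite (eq_sym w) andbCA; case: ifP; last by rewrite oppr0.
case/and3P=> wF vF nvw; rewrite (sgn_swap vF wF) // mulNr scaleNr; congr (- (_ *: _)).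
  by rewrite (mulrC (a v)).
by congr f; apply/setP => x; rewrite !inE andbCA.
Qed.

End Coboundary.

Section LinearCobd.
Variables (R : comNzRingType) (N : nat) (V W : lmodType R) (h : {linear V -> W}).
Lemma cobd_linear a (f : {set 'I_N} -> V) F :
  h (cobd a f F) = cobd a (fun G => h (f G)) F.
Proof. by rewrite /cobd linear_sum; apply: eq_bigr => v _; rewrite linearZ. Qed.
End LinearCobd.

(** * Minors and Cramer's rule *)

Section Minors.
Variables (R : comNzRingType) (N : nat) (th : nat -> 'I_N -> R).
Implicit Types (F G K : {set 'I_N}) (u v w : 'I_N).

(** The minors of the first [r] rows, as an iterated exterior product.  This
    Laplace expansion along the last row needs no enumeration of the columns,
    and its signs are those of the simplicial boundary. *)
Fixpoint minor (r : nat) : {set 'I_N} -> R^o :=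
  if r is r'.+1 then cobd (th r') (minor r') else fun F => (F == set0)%:R.

Lemma cobd_row_minor i r F : (i < r)%N -> cobd (th i) (minor r) F = 0.
Proof.
elim: r F => // r IH F; rewrite ltnS leq_eqVlt => /orP [/eqP -> | ir] /=.
  exact: cobd_sq.
rewrite cobd_anti /cobd big1 ?oppr0 // => v _.
by rewrite [X in _ *: X]IH ?scaler0.
Qed.

Definition row_span (r : nat) (e : 'I_N -> R) :=
  exists c : nat -> R, forall u, e u = \sum_(i < r) c i * th i u.

Lemma row_span_row i r : (i < r)%N -> row_span r (th i).
Proof.
move=> ir; exists (fun j => (j == i)%:R) => u.
rewrite (bigD1 (Ordinal ir)) //= eqxx mul1r big1 ?addr0 // => j /eqP nj.
by case: eqP => [E|]; rewrite ?mul0r //; case: nj; apply: val_inj.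
Qed.

Lemma row_spanS r s e : (r <= s)%N -> row_span r e -> row_span s e.
Proof.
move=> rs [c cE]; exists (fun i => if (i < r)%N then c i else 0) => u.
rewrite cE (big_ord_widen _ (fun i => c i * th i u) rs) big_mkcond.
by apply: eq_bigr => i _; case: ifP => _; rewrite ?mul0r.
Qed.

Lemma row_span_sum r (I : finType) (P : pred I) (x : I -> R) (e : I -> 'I_N -> R) :
  (forall i, P i -> row_span r (e i)) ->
  row_span r (fun u => \sum_(i | P i) x i * e i u).
Proof.
move=> he.
have /fin_all_exists [c cE] : forall i, exists c : nat -> R, P i ->
    forall u, e i u = \sum_(j < r) c j * th j u.
  move=> i; case: (boolP (P i)) => [/he [c cE]|_]; first by exists c.
  by exists (fun _ => 0).
exists (fun j => \sum_(i | P i) x i * c i j) => u.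
under [RHS]eq_bigr => j _ do rewrite mulr_suml.
rewrite exchange_big /=; apply: eq_bigr => i Pi; rewrite cE // mulr_sumr.
by apply: eq_bigr => j _; rewrite mulrA.
Qed.

Lemma row_spanZ r x e : row_span r e -> row_span r (fun u => x * e u).
Proof.
case=> c cE; exists (fun j => x * c j) => u; rewrite cE mulr_sumr.
by apply: eq_bigr => j _; rewrite mulrA.
Qed.

Lemma row_spanB r e e' : row_span r e -> row_span r e' ->
  row_span r (fun u => e u - e' u).
Proof.
case=> c cE [c' cE']; exists (fun j => c j - c' j) => u; rewrite cE cE' -sumrB.
by apply: eq_bigr => j _; rewrite mulrBl.
Qed.

Lemma eq_row_span r e e' : e =1 e' -> row_span r e -> row_span r e'.
Proof. by move=> ee [c cE]; exists c => u; rewrite -ee. Qed.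

(** Cramer's rule: expanding the minors on the sets [u |: G] along [u] gives a
    combination of the rows that vanishes on [G]. *)
Definition cramer r G u : R :=
  if u \in G then 0 else sgn R u (u |: G) * minor r (u |: G).

Lemma cramerS r G u : cramer r.+1 G u =
  minor r G * th r u - \sum_(v in G) (sgn R v G * th r v) * cramer r (G :\ v) u.
Proof.
rewrite {1}/cramer; case: ifPn => uG.
  rewrite (bigD1 u) //= big1 => [|v /andP [vG nv]]; last first.
    by rewrite /cramer !inE eq_sym nv uG mulr0.
  rewrite /cramer setD11 setD1K // addr0 mulrACA sgn_sq mul1r.
  by rewrite mulrC subrr.
rewrite /= {1}/cobd (bigD1 u) ?setU11 //= mulrDr; congr (_ + _).
  rewrite [_ *: _]/(_ * _) !mulrA sgn_sq mul1r mulrC; congr (_ * _).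
  by congr minor; apply/setP => x; rewrite !inE; case: eqP => // ->; rewrite (negbTE uG).
rewrite mulr_sumr -sumrN; apply: eq_big => v.
  rewrite !inE; case: (eqVneq v u) => [->|]; rewrite ?andbT //=.
  by rewrite (negbTE uG).
rewrite !inE => /andP [/orP [/eqP->|vG] nvu]; first by rewrite eqxx in nvu.
rewrite /cramer !inE eq_sym (negbTE nvu) (negbTE uG) /=.
have E : (u |: G) :\ v = u |: G :\ v.
  by apply/setP => x; rewrite !inE; case: (eqVneq x u) => [->|]; rewrite // eq_sym nvu.
have := @sgn_swap R N v u (u |: G).
rewrite !inE vG orbT eqxx nvu => /(_ isT isT isT); rewrite E.
have -> : (u |: G) :\ u = G.
  by apply/setP => x; rewrite !inE; case: eqP => // ->; rewrite (negbTE uG).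
move=> sw; rewrite [_ *: _]/(_ * _).
suff -> : sgn R v G * th r v * (sgn R u (u |: G :\ v) * minor r (u |: G :\ v)) =
   - (sgn R u (u |: G) * (sgn R v (u |: G) * th r v * minor r (u |: G :\ v))).
  by rewrite opprK.
have {}sw : sgn R v G = - (sgn R u (u |: G) * (sgn R v (u |: G) * sgn R u (u |: G :\ v))).
  by rewrite sw mulrN opprK mulrA sgn_sq mul1r.
rewrite sw !mulNr; congr (- _); rewrite !mulrA.
rewrite -[LHS]/(_ * _) [LHS](_ : _ = sgn R u (u |: G) * sgn R v (u |: G) * th r v *
  (sgn R u (u |: G :\ v) * sgn R u (u |: G :\ v)) * minor r (u |: G :\ v)).
  by rewrite sgn_sq mulr1.
by rewrite !mulrA; congr (_ * _); rewrite -!mulrA; congr (_ * (_ * _)); rewrite mulrCA.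
Qed.

Lemma cramer_row_span r G : row_span r (cramer r G).
Proof.
elim: r G => [|r IH] G.
  exists (fun _ => 0) => u; rewrite big_ord0 /cramer; case: ifP => //= _.
  rewrite (_ : (u |: G == set0) = false) ?mulr0 ?mul0r //.
  by apply/negbTE/set0Pn; exists u; rewrite setU11.
apply: (@eq_row_span _ (fun u => minor r G * th r u -
    \sum_(v in G) (sgn R v G * th r v) * cramer r (G :\ v) u)).
  by move=> u; rewrite cramerS.
apply: row_spanB; first by apply/row_spanZ/row_span_row.
by apply: row_span_sum => v _; apply: row_spanS (IH _).
Qed.

Lemma cobd_row_span_minor r e F : row_span r e -> cobd e (minor r) F = 0.
Proof.
case=> c cE.
transitivity (\sum_(i < r) c i *: cobd (th i) (minor r) F).
  under [RHS]eq_bigr => i _ do rewrite /cobd scaler_sumr.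
  rewrite exchange_big /=; apply: eq_bigr => v _.
  rewrite cE mulr_sumr scaler_suml; apply: eq_bigr => i _.
  by rewrite scalerA; congr (_ *: _); rewrite mulrCA.
by rewrite big1 // => i _; rewrite cobd_row_minor // scaler0.
Qed.

End Minors.

Section DualForms.
Variables (k : fieldType) (N : nat) (th : nat -> 'I_N -> k).
Implicit Types (F G K : {set 'I_N}) (u v w : 'I_N) (e : 'I_N -> k).

Lemma sgn_neq0 v F : sgn k v F != 0.
Proof. by rewrite /sgn signr_eq0. Qed.

(** The solution of the linear system on [K] by Cramer's rule. *)
Lemma dual_form r K v : minor th r K != 0 -> v \in K ->
  exists2 e, row_span th r e & forall u, u \in K -> e u = (u == v)%:R.
Proof.
move=> mK vK; pose x := (sgn k v K * minor th r K)^-1.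
exists (fun u => x * cramer th r (K :\ v) u).
  exact/row_spanZ/cramer_row_span.
move=> u uK; rewrite /cramer; case: (eqVneq u v) => [->|nuv].
  by rewrite setD11 setD1K // mulVf // mulf_neq0 // sgn_neq0.
by rewrite !inE nuv uK mulr0.
Qed.

Lemma cobd_vanish_minor r K w e : w \notin K -> {in K, forall u, e u = 0} ->
  cobd e (minor th r) (w |: K) = sgn k w (w |: K) * e w * minor th r K.
Proof.
move=> wK eK; rewrite /cobd (bigD1 w) ?setU11 //= big1 ?addr0.
  by rewrite [_ *: _]/(_ * _) setU1K.
move=> u; rewrite !inE => /andP [/orP [->//|uK] _].
by rewrite eK // mulr0 scale0r.
Qed.

(** The exterior product of [e] with the product of the rows is zero; at
    [w |: K] it is, up to sign, [e w] times the minor on [K]. *)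
Lemma row_span_vanish r K e : minor th r K != 0 -> row_span th r e ->
  {in K, forall u, e u = 0} -> e =1 (fun _ => 0).
Proof.
move=> mK he eK w; have [wK|wK] := boolP (w \in K); first exact: eK.
have := cobd_vanish_minor r wK eK; rewrite cobd_row_span_minor //.
move/esym/eqP; rewrite !mulf_eq0 (negbTE mK) orbF signr_eq0 /=.
by move/eqP.
Qed.

(** Reducing the row [r] by the previous ones does not change the minor of size
    [r.+1] on [w |: K], which becomes, up to sign, the product of the value at
    [w] and the minor on [K]. *)
Lemma reduced_row_neq0 r K e w : row_span th r e -> w \notin K ->
  {in K, forall u, th r u - e u = 0} -> minor th r.+1 (w |: K) != 0 ->
  th r w - e w != 0.
Proof.
move=> he wK eK; apply: contra => /eqP ew.
have -> : minor th r.+1 (w |: K) = cobd (fun u => th r u - e u) (minor th r) (w |: K).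
  rewrite -[LHS]subr0 -[X in _ - X](cobd_row_span_minor (w |: K) he) /= /cobd -sumrB.
  by apply: eq_bigr => v _; rewrite -scalerBl mulrBr.
by rewrite cobd_vanish_minor // ew mulr0 mul0r.
Qed.

End DualForms.

(** * Generic rows *)

Section MinorMorphism.
Variables (R S : comNzRingType) (h : {rmorphism R -> S}) (N : nat).

Lemma rmorph_minor (th : nat -> 'I_N -> R) r F :
  h (minor th r F) = minor (fun i u => h (th i u)) r F.
Proof.
elim: r F => [|r IH] F /=; first by rewrite rmorph_nat.
rewrite /cobd [LHS](rmorph_sum h); apply: eq_bigr => v _.
rewrite [X in h X]/(_ * _) (rmorphM h) (rmorphM h) (rmorph_sign h).
by rewrite [h (minor _ _ _)]IH.
Qed.

Lemma eq_minor (th th' : nat -> 'I_N -> R) r F :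
  (forall i, (i < r)%N -> th i =1 th' i) -> minor th r F = minor th' r F.
Proof.
elim: r F => [|r IH] F //= E; apply: eq_bigr => v _.
by rewrite E // IH // => i ir; apply: E; apply: ltnW.
Qed.

End MinorMorphism.

Section GenericRows.
Variables (k : fieldType) (N : nat).

Definition generic_rows d (th : nat -> 'I_N -> k) :=
  forall F : {set 'I_N}, (#|F| <= d)%N -> minor th #|F| F != 0.

Lemma exists_nonroot (p : {poly k}) :
  infinite_field k -> p != 0 -> exists x, ~~ root p x.
Proof.
move=> kinf p0.
have [s us ss] : exists2 s : seq k, uniq s & size s = size p.
  elim: (size p) => [|m [s us ss]]; first by exists [::].
  by have [x xs] := kinf s; exists (x :: s); rewrite /= ?xs ?us ?ss.
have : ~~ all (root p) s.
  by apply/negP => /(max_poly_roots p0)/(_ us); rewrite ss ltnn.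
by case/allPn => x _ rx; exists x.
Qed.

(** Rows of the form [(1, s, s ^+ 2, ...)] are added one at a time: once the
    previous rows are chosen, each minor of the next size is a nonzero
    polynomial in [s]. *)
Lemma exists_generic_rows d : infinite_field k -> exists th, generic_rows d th.
Proof.
move=> kinf; elim: d => [|d [th thP]].
  exists (fun _ _ => 0) => F; rewrite leqn0 => /eqP F0; rewrite F0 /=.
  by move/eqP: F0; rewrite cards_eq0 => ->; rewrite oner_neq0.
pose P (F : {set 'I_N}) : {poly k} :=
  \sum_(v in F) (sgn k v F * minor th d (F :\ v)) *: 'X^v.
have P0 (F : {set 'I_N}) : #|F| = d.+1 -> P F != 0.
  move=> Fd; have /card_gt0P [v vF] : (0 < #|F|)%N by rewrite Fd.
  have Fvd : #|F :\ v| = d.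
    by move: Fd; rewrite (cardsD1 v F) vF; case.
  apply/eqP => /(congr1 (fun p : {poly k} => p`_v)); rewrite coef0 coef_sum.
  rewrite (bigD1 v) //= big1 => [|u /andP [_ nuv]]; last first.
    rewrite coefZ coefXn; case: eqP => [/val_inj E|]; rewrite ?mulr0 //.
    by rewrite E eqxx in nuv.
  rewrite coefZ coefXn eqxx mulr1 addr0 => /eqP.
  rewrite mulf_eq0 (negbTE (sgn_neq0 _ _ _)) /=; apply/negP.
  by have := thP (F :\ v); rewrite Fvd => /(_ (leqnn _)).
have [s sP] : exists s, ~~ root (\prod_(F : {set 'I_N} | #|F| == d.+1) P F) s.
  apply: exists_nonroot => //; by apply/prodf_neq0 => F /eqP; apply: P0.
exists (fun i => if (i < d)%N then th i else fun u => s ^+ u) => F.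
rewrite leq_eqVlt => /orP [/eqP Fd|]; last first.
  rewrite ltnS => Fd; rewrite (@eq_minor _ _ _ th); first exact: thP.
  by move=> i iF; rewrite (leq_trans iF Fd).
move: sP; rewrite rootE horner_prod; move/prodf_neq0/(_ F).
rewrite Fd eqxx => /(_ isT); apply: contraNneq => <- /=.
rewrite /P horner_sum; apply/eqP; apply: eq_bigr => v _.
rewrite hornerZ hornerXn ltnn [_ *: _]/(_ * _) mulrAC; congr (_ * _ * _).
by apply: eq_minor => i ->.
Qed.

(** Rows indexed by all natural numbers, so that initial segments of the rows
    need no casts. *)
Definition nat_rows (R : nzRingType) d (A : 'I_d -> 'I_N -> R) (i : nat) (u : 'I_N) : R :=
  if insub i is Some i' then A i' u else 0.

Lemma nat_rowsE (R : nzRingType) d (A : 'I_d -> 'I_N -> R) (i : 'I_d) :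
  nat_rows A i = A i.
Proof. by rewrite /nat_rows valK. Qed.

Lemma rmorph_nat_rows (R S : nzRingType) (h : {rmorphism R -> S}) d
    (A : 'I_d -> 'I_N -> R) i u :
  h (nat_rows A i u) = nat_rows (fun i u => h (A i u)) i u.
Proof. by rewrite /nat_rows; case: insubP => // _; rewrite rmorph0. Qed.

(** The open set is where the product of all these minors, a polynomial in the
    entries of the matrix, does not vanish. *)
Lemma generic_rows_generic d (Q : 'M[k]_(d, N) -> Prop) : infinite_field k ->
  (forall A : 'M[k]_(d, N), generic_rows d (nat_rows A) -> Q A) -> generic Q.
Proof.
move=> kinf HQ; exists (fun A : 'M[k]_(d, N) => generic_rows d (nat_rows A)); split=> //.
  pose X := nat_rows (fun i u => 'X_(mxvec_index i u) : {mpoly k[d * N]}).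
  pose p : {mpoly k[d * N]} := \prod_(F : {set 'I_N} | (#|F| <= d)%N) minor X #|F| F.
  have pE (A : 'M[k]_(d, N)) : p.@[mxvec A 0] =
      \prod_(F : {set 'I_N} | (#|F| <= d)%N) minor (nat_rows A) #|F| F.
    rewrite /p rmorph_prod; apply: eq_bigr => F _.
    rewrite [LHS](rmorph_minor (meval (mxvec A 0))); apply: eq_minor => i _ u.
    rewrite (rmorph_nat_rows (meval (mxvec A 0))) /nat_rows.
    by case: insubP => // j _ _; rewrite [LHS]mevalXU mxvecE.
  exists [:: p] => A; split => [gA|[q]].
    by exists p; rewrite ?mem_seq1 // pE; apply/prodf_neq0.
  rewrite mem_seq1 => /eqP ->; rewrite pE => /prodf_neq0 H F Fd; exact: H.
have [th thP] := exists_generic_rows d kinf.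
exists (\matrix_(i, u) th i u) => F Fd; rewrite (@eq_minor _ _ _ th); first exact: thP.
move=> i iF u; have id : (i < d)%N by apply: leq_trans Fd.
by rewrite -[i]/(nat_of_ord (Ordinal id)) nat_rowsE mxE.
Qed.

End GenericRows.

(** * Cohomology of simplicial complexes *)

Section Cohomology.
Variables (k : fieldType) (n : nat).
Implicit Types (X L M : {set {set 'I_n}}) (F G H K : {set 'I_n}).
Implicit Types (f g : {set 'I_n} -> k).
Local Notation chain := (chain_space n k).
Local Notation co c F := ((c : {ffun {set 'I_n} -> k^o}) F).

Definition cob f F : k := \sum_(v in F) sgn k v F * f (F :\ v).

Lemma cob_cobd f F : cob f F = cobd (V := k^o) (fun _ => 1) f F.
Proof. by apply: eq_bigr => v _; rewrite mulr1. Qed.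

Lemma cob_cob f F : cob (cob f) F = 0.
Proof.
rewrite cob_cobd -[RHS](@cobd_sq k n k^o (fun _ => 1) f F).
by apply: eq_bigr => v _; rewrite cob_cobd.
Qed.

Lemma cob_lin a b f g F :
  cob (fun G => a * f G + b * g G) F = a * cob f F + b * cob g F.
Proof.
rewrite /cob !mulr_sumr -big_split; apply: eq_bigr => v _ /=.
by rewrite mulrDr !(mulrCA _ (sgn _ _ _)).
Qed.

Lemma eq_cob f g F : (forall v, v \in F -> f (F :\ v) = g (F :\ v)) ->
  cob f F = cob g F.
Proof. by move=> fg; apply: eq_bigr => v vF; rewrite fg. Qed.

Definition cocycle X j f := forall K, K \in X -> #|K| = j.+1 -> cob f K = 0.

Definition coexact X j f := exists g, forall H, H \in X -> #|H| = j -> f H = cob g H.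

(** As for the Betti numbers, [j] is the number of elements of the faces, that
    is, the cohomological degree plus one. *)
Definition coh_zero X j := forall f, cocycle X j f -> coexact X j f.

(** Dimension at most one, stated without a quotient: any two classes are
    linearly dependent. *)
Definition coh_le1 X j := forall f1 f2, cocycle X j f1 -> cocycle X j f2 ->
  exists a b, ((a != 0) || (b != 0)) /\ coexact X j (fun H => a * f1 H + b * f2 H).

Lemma cocycle_lin X j a b f g : cocycle X j f -> cocycle X j g ->
  cocycle X j (fun H => a * f H + b * g H).
Proof. by move=> hf hg K KX Kj; rewrite cob_lin hf // hg // !mulr0 addr0. Qed.

Definition pairing f (c : chain) : k := \sum_F f F * co c F.

Lemma pairingD f c d : pairing f (c + d) = pairing f c + pairing f d.
Proof. by rewrite /pairing -big_split; apply: eq_bigr => F _; rewrite ffunE mulrDr. Qed.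

Lemma pairingZ f a c : pairing f (a *: c) = a * pairing f c.
Proof.
rewrite /pairing mulr_sumr; apply: eq_bigr => F _.
by rewrite ffunE -[a *: _]/(a * _) mulrCA.
Qed.

Lemma pairing_lin a b f g c :
  pairing (fun H => a * f H + b * g H) c = a * pairing f c + b * pairing g c.
Proof.
rewrite /pairing !mulr_sumr -big_split; apply: eq_bigr => F _ /=.
by rewrite mulrDl !mulrA.
Qed.

Lemma pairing_face f F : pairing f (face_chain k F) = f F.
Proof.
rewrite /pairing (bigD1 F) //= ffunE eqxx mulr1 big1 ?addr0 // => G nG.
by rewrite ffunE (negbTE nG) mulr0.
Qed.

Lemma pairing_sum f (I : finType) (P : pred I) (c : I -> chain) :
  pairing f (\sum_(i | P i) c i) = \sum_(i | P i) pairing f (c i).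
Proof.
have p0 : pairing f 0 = 0 by rewrite /pairing big1 // => F _; rewrite ffunE mulr0.
exact: (big_morph (pairing f) (pairingD f) p0).
Qed.

Lemma chain_sum (c : chain) : c = \sum_F co c F *: face_chain k F.
Proof.
apply/ffunP => G; rewrite sum_ffunE (bigD1 G) //= !ffunE eqxx big1.
  by rewrite addr0 -[_ *: _]/(_ * _) mulr1.
by move=> F nF; rewrite !ffunE eq_sym (negbTE nF) scaler0.
Qed.

Lemma boundary_faceE F : boundary_face k F = cobd (fun _ => 1) (@face_chain n k) F.
Proof. by apply: eq_bigr => v _; rewrite mulr1. Qed.

Lemma boundary_fun_face F : boundary_fun (face_chain k F) = boundary_face k F.
Proof.
rewrite /boundary_fun (bigD1 F) //= ffunE eqxx scale1r big1 ?addr0 // => G nG.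
by rewrite ffunE (negbTE nG) scale0r.
Qed.

Lemma boundary_funK (c : chain) : boundary_fun (boundary_fun c) = 0.
Proof.
rewrite {2}/boundary_fun linear_sum big1 // => F _.
rewrite linearZ /= boundary_faceE (cobd_linear (@boundary_fun n k)).
rewrite -[X in _ *: X](_ : 0 = _) ?scaler0 //.
rewrite -[LHS](cobd_sq (fun _ => 1) (@face_chain n k) F).
apply: eq_cobd => v _; apply/esym.
exact: etrans (boundary_fun_face _) (boundary_faceE _).
Qed.

Lemma pairing_boundary_face f F : pairing f (boundary_face k F) = cob f F.
Proof.
rewrite /boundary_face pairing_sum; apply: eq_bigr => v _.
by rewrite pairingZ pairing_face.
Qed.

Lemma pairing_boundary f (c : chain) :
  pairing f (boundary_fun c) = pairing (cob f) c.
Proof.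
rewrite /boundary_fun pairing_sum; apply: eq_bigr => F _.
by rewrite pairingZ pairing_boundary_face mulrC.
Qed.

Lemma chainsP X j (c : chain) :
  reflect (forall F, co c F != 0 -> F \in X /\ #|F| = j) (c \in chains k X j).
Proof.
apply: (iffP idP) => [|H].
  rewrite /chains; set s := [seq _ | _ <- _ & _] => cs F.
  rewrite (coord_span (X := in_tuple s) cs) sum_ffunE.
  move=> nF; suff /andP [-> /eqP] : (F \in X) && (#|F| == j) by [].
  apply: contraNT nF => nF; apply/eqP; apply: big1 => i _; rewrite ffunE.
  have /mapP [G] : (in_tuple s)`_i \in s by rewrite mem_nth.
  rewrite mem_filter mem_enum => /andP [/eqP Gj GX] ->.
  rewrite ffunE; case: eqP => [E|]; rewrite ?scaler0 //.
  by case/negP: nF; rewrite E GX Gj eqxx.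
rewrite (chain_sum c); apply: memv_suml => F _.
have [->|/H [FX Fj]] := eqVneq (co c F) 0; first by rewrite scale0r mem0v.
by apply/memvZ/memv_span/map_f; rewrite mem_filter Fj eqxx mem_enum.
Qed.

Lemma boundary_chain_card j (c : chain) G : (forall F, co c F != 0 -> #|F| = j) ->
  co (boundary_fun c) G != 0 -> #|G| = j.-1.
Proof.
move=> Hc nG; apply/eqP; apply: contraNT nG => nG; rewrite sum_ffunE.
apply/eqP; apply: big1 => F _; rewrite ffunE.
have [->|/Hc Fj] := eqVneq (co c F) 0; first by rewrite scale0r.
rewrite /boundary_face sum_ffunE big1 ?scaler0 // => v vF; rewrite !ffunE.
case: eqP => [E|]; rewrite ?scaler0 //.
by case/negP: nG; rewrite E -Fj (cardsD1 v F) vF.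
Qed.

Lemma boundary_chain_closed X j (c : chain) :
  (forall F G, F \in X -> G \subset F -> G \in X) ->
  c \in chains k X j -> boundary_fun c \in chains k X j.-1.
Proof.
move=> Xc /chainsP Hc; apply/chainsP => G nG; split; last first.
  by apply: boundary_chain_card nG => F /Hc [].
move: nG; rewrite sum_ffunE; apply: contraR => nG; apply/eqP.
apply: big1 => F _; rewrite ffunE.
have [->|/Hc [FX Fj]] := eqVneq (co c F) 0; first by rewrite scale0r.
rewrite /boundary_face sum_ffunE big1 ?scaler0 // => v vF; rewrite !ffunE.
case: eqP => [E|]; rewrite ?scaler0 //.
by case/negP: nG; rewrite E (Xc F) // subsetDl.
Qed.

Lemma boundary_mapE (c : chain) : boundary_map n k c = boundary_fun c.
Proof. by rewrite lfunE. Qed.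

Lemma rel_cyclesP L M j (c : chain) :
  reflect (c \in chains k L j /\ boundary_fun c \in chains k M j.-1)
          (c \in rel_cycles k L M j).
Proof. by rewrite memv_cap -memv_preim boundary_mapE; apply: andP. Qed.

Section Factor.
Variables (L M : {set {set 'I_n}}) (j : nat) (f : {set 'I_n} -> k).

Let P (c : chain) : chain := [ffun F => if (F \in L) && (#|F| == j) then co c F else 0].
Let T (c : chain) : chain := [ffun G => if G \in M then 0 else co (boundary_fun (P c)) G].
Let phi (c : chain) : k^o := pairing f (P c).

Let P_linear : linear P.
Proof.
move=> a c d; apply/ffunP => F; rewrite !ffunE; case: ifP => // _.
by rewrite scaler0 addr0.
Qed.

Let T_linear : linear T.
Proof.
move=> a c d; apply/ffunP => G; rewrite !ffunE P_linear linearP !ffunE.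
by case: ifP => // _; rewrite scaler0 addr0.
Qed.

Let phi_linear : linear phi.
Proof. by move=> a c d; rewrite /phi P_linear pairingD pairingZ. Qed.

HB.instance Definition _ := GRing.isLinear.Build k chain chain _ T T_linear.
HB.instance Definition _ := GRing.isLinear.Build k chain k^o _ phi phi_linear.

(** A functional that vanishes on the kernel of a linear map factors through it;
    here the map is the boundary, followed by the projection away from [M]. *)
Lemma coexact_rel :
  (forall c, c \in rel_cycles k L M j -> pairing f c = 0) ->
  exists g, {in M, forall H, g H = 0} /\
    forall F, F \in L -> #|F| = j -> f F = cob g F.
Proof.
move=> Hf; pose t := linfun T.
have kerT c : T c = 0 -> phi c = 0.
  move=> Tc; apply: Hf; apply/rel_cyclesP; split; apply/chainsP => F.
    by rewrite ffunE; case: ifP => [/andP [? /eqP ?] //|_]; rewrite eqxx.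
  move=> nF; split.
    apply: contraNT nF => FM; have /ffunP/(_ F) := Tc.
    by rewrite !ffunE (negbTE FM) => ->.
  apply: boundary_chain_card nF => G; rewrite ffunE.
  by case: ifP => [/andP [_ /eqP] //|_]; rewrite eqxx.
have phiK c : phi (t^-1 (T c))%VF = phi c.
  apply/eqP; rewrite -subr_eq0 -linearB /=; apply/eqP/kerT.
  rewrite linearB /= -[T (_ _)](lfunE T) -/t.
  by rewrite limg_lfunVK ?subrr // -[T c](lfunE T) memv_img ?memvf.
exists (fun H => if H \in M then 0 else phi (t^-1 (face_chain k H))%VF).
split=> [H HM|F FL Fj]; first by rewrite HM.
have <- : phi (face_chain k F) = f F.
  rewrite /phi (_ : P _ = face_chain k F) ?pairing_face //.
  apply/ffunP => G; rewrite !ffunE.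
  by have [->|_] := eqVneq G F; rewrite ?FL ?Fj ?eqxx ?if_same.
rewrite -phiK [T _]chain_sum linear_sum linear_sum -pairing_boundary_face.
apply: eq_bigr => G _; rewrite !linearZ /= ffunE -[_ *: _]/(_ * _).
case: ifP => _; rewrite ?mul0r // mulrC; congr (_ * co _ _).
rewrite -boundary_fun_face; congr boundary_fun.
apply/ffunP => H; rewrite !ffunE.
by have [->|_] := eqVneq H F; rewrite ?FL ?Fj ?eqxx ?if_same.
Qed.

End Factor.

Definition downward X := forall F G, F \in X -> G \subset F -> G \in X.

Lemma rel_boundaries_sub L M j : downward L -> downward M -> M \subset L ->
  (rel_boundaries k L M j <= rel_cycles k L M j)%VS.
Proof.
move=> Lc Mc ML; rewrite /rel_boundaries subv_add; apply/andP; split; apply/subvP => c.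
  case/memv_imgP => b bL ->; rewrite boundary_mapE; apply/rel_cyclesP.
  rewrite boundary_funK mem0v; split=> //.
  exact: (boundary_chain_closed Lc bL).
move=> cM; apply/rel_cyclesP; split; last exact: boundary_chain_closed.
by apply/chainsP => F /(chainsP _ _ _ cM) [FM ->]; rewrite (subsetP ML).
Qed.

Lemma rel_betti0 L M j : downward L -> downward M -> M \subset L ->
  rel_betti k L M j = 0%N -> (rel_cycles k L M j <= rel_boundaries k L M j)%VS.
Proof.
move=> Lc Mc ML /eqP; rewrite subn_eq0 => le.
have sub := rel_boundaries_sub j Lc Mc ML.
suff /eqP -> : rel_boundaries k L M j == rel_cycles k L M j by exact: subvv.
by rewrite eqEdim sub.
Qed.

Lemma rel_betti1 L M j : downward L -> downward M -> M \subset L ->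
  rel_betti k L M j = 1%N -> exists z, [/\ z \in rel_cycles k L M j,
    z \notin rel_boundaries k L M j &
    (rel_cycles k L M j <= rel_boundaries k L M j + <[z]>)%VS].
Proof.
move=> Lc Mc ML; rewrite /rel_betti.
have := rel_boundaries_sub j Lc Mc ML.
set B := rel_boundaries _ _ _ _; set Z := rel_cycles _ _ _ _ => BZ b1.
have /subvPn [z zZ zB] : ~~ (Z <= B)%VS.
  by apply/negP => /dimvS; lia.
exists z; split=> //.
have sub : (B + <[z]> <= Z)%VS by rewrite subv_add BZ -memvE.
rewrite -(geq_leqif (dimv_leqif_sup sub)).
have := dimvS (addvSl B <[z]>).
rewrite leq_eqVlt => /orP [/eqP E|]; last by move: b1; lia.
case/negP: zB; have : (B == B + <[z]>)%VS by rewrite eqEdim addvSl E leqnn.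
by move/eqP ->; rewrite memvE addvSr.
Qed.

Lemma coexact_rel1 L M j f1 f2 : downward L -> downward M -> M \subset L ->
  rel_betti k L M j = 1%N ->
  (forall c, c \in rel_boundaries k L M j -> pairing f1 c = 0 /\ pairing f2 c = 0) ->
  exists a b, ((a != 0) || (b != 0)) /\
  exists g, {in M, forall H, g H = 0} /\
    forall F, F \in L -> #|F| = j -> a * f1 F + b * f2 F = cob g F.
Proof.
move=> Lc Mc ML b1 fB; have [z [zZ _ Zz]] := rel_betti1 Lc Mc ML b1.
have [a [b [nab ab]]] : exists a b : k, ((a != 0) || (b != 0)) /\
    a * pairing f1 z + b * pairing f2 z = 0.
  have [E|N] := eqVneq (pairing f1 z) 0.
    by exists 1, 0; rewrite oner_neq0 E mulr0 mul0r addr0.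
  exists (- pairing f2 z), (pairing f1 z); rewrite N orbT; split=> //.
  by rewrite mulrC mulrN addNr.
exists a, b; split=> //; apply: (@coexact_rel _ _ _ (fun H => a * f1 H + b * f2 H)) => c cZ.
have /memv_addP [u uB [v /vlineP [x ->] ->]] := subvP Zz _ cZ.
have [u1 u2] := fB _ uB.
by rewrite pairing_lin !pairingD !pairingZ u1 u2 !add0r !(mulrCA _ x) -mulrDr ab mulr0.
Qed.

Lemma downward0 : downward set0.
Proof. by move=> F G; rewrite inE. Qed.

Lemma cocycle_boundaries X j f c : cocycle X j f ->
  c \in rel_boundaries k X set0 j -> pairing f c = 0.
Proof.
move=> fX /memv_addP [u /memv_imgP [b bX ->] [v vM ->]].
have -> : v = 0.
  apply/ffunP => F; rewrite [RHS]ffunE; apply/eqP; apply: contraT.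
  by move/(chainsP _ _ _ vM) => []; rewrite inE.
rewrite addr0 boundary_mapE pairing_boundary /pairing big1 // => F _.
have [->|] := eqVneq (co b F) 0; first by rewrite mulr0.
by move/(chainsP _ _ _ bX) => [FX Fj]; rewrite fX // mul0r.
Qed.

Lemma coh_zero_betti X j : downward X -> red_betti k X j = 0%N -> coh_zero X j.
Proof.
move=> Xc b0 f fX; have [|g [_ gE]] := @coexact_rel X set0 j f; last by exists g.
move=> c /(subvP (rel_betti0 Xc downward0 (sub0set _) b0)).
exact: cocycle_boundaries.
Qed.

Lemma coh_le1_betti X j : downward X -> red_betti k X j = 1%N -> coh_le1 X j.
Proof.
move=> Xc b1 f1 f2 f1X f2X.
have [|a [b [nab [g [_ gE]]]]] := @coexact_rel1 X set0 j f1 f2 Xc downward0 (sub0set _) b1.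
  by move=> c cB; split; apply: cocycle_boundaries cB.
by exists a, b; split=> //; exists g.
Qed.

Lemma coh_zero_acyclic X j : downward X -> acyclic k X -> coh_zero X j.
Proof.
move=> Xc /forallP Xa; have [jn|jn] := leqP j n.
  by apply: coh_zero_betti => //; apply/eqP/(Xa (Ordinal (jn : (j < n.+1)%N))).
move=> f _; exists f => H _ Hj; have := max_card (mem H); rewrite Hj card_ord; lia.
Qed.

End Cohomology.

(** * Attaching a cone to a complex *)

Section Cone.
Variables (k : fieldType) (n : nat).
Implicit Types (L M : {set {set 'I_n}}) (F G H K : {set 'I_n}).
Implicit Types (X : {set {set 'I_n.+1}}) (E : {set 'I_n.+1}).
Implicit Types (f g : {set 'I_n.+1} -> k).

(** The vertices of the base are shifted by [lift ord0].  The apex [ord0] then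
    precedes them, and removing it from a face has the sign [1]. *)
Definition up F : {set 'I_n.+1} := lift ord0 @: F.
Definition upc F : {set 'I_n.+1} := ord0 |: up F.
Definition down E : {set 'I_n} := lift ord0 @^-1: E.

Lemma lift_inj0 : injective (@lift n.+1 ord0).
Proof. exact: lift_inj. Qed.

Lemma mem_up u F : (lift ord0 u \in up F) = (u \in F).
Proof. exact: mem_imset lift_inj0. Qed.

Lemma ord0_up F : (ord0 \in up F) = false.
Proof. by apply/imsetP => -[u _ /eqP]; rewrite (negbTE (neq_lift _ _)). Qed.

Lemma mem_upc u F : (lift ord0 u \in upc F) = (u \in F).
Proof. by rewrite !inE eq_sym (negbTE (neq_lift _ _)) mem_up. Qed.

Lemma ord0_upc F : ord0 \in upc F. Proof. exact: setU11. Qed.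

Lemma upK : cancel up down.
Proof. by move=> F; apply/setP => u; rewrite inE mem_up. Qed.

Lemma upcK : cancel upc down.
Proof. by move=> F; apply/setP => u; rewrite inE mem_upc. Qed.

Lemma setP_lift (E E' : {set 'I_n.+1}) :
  (ord0 \in E) = (ord0 \in E') -> down E = down E' -> E = E'.
Proof.
move=> E0 /setP Ed; apply/setP => x; case: (unliftP ord0 x) => [u|] -> //.
by have := Ed u; rewrite !inE.
Qed.

Lemma downK E : E = if ord0 \in E then upc (down E) else up (down E).
Proof.
case: ifP => E0; apply: setP_lift; rewrite ?upK ?upcK ?ord0_upc ?ord0_up //.
Qed.

Lemma up_upc_ind (P : {set 'I_n.+1} -> Prop) :
  (forall F, P (up F)) -> (forall F, P (upc F)) -> forall E, P E.
Proof. by move=> Hu Hc E; rewrite (downK E); case: ifP. Qed.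

Lemma card_up F : #|up F| = #|F|.
Proof. exact: card_imset lift_inj0. Qed.

Lemma card_upc F : #|upc F| = #|F|.+1.
Proof. by rewrite cardsU1 ord0_up card_up. Qed.

Lemma up_inj : injective up. Proof. exact: can_inj upK. Qed.
Lemma upc_inj : injective upc. Proof. exact: can_inj upcK. Qed.

Lemma upU F G : up (F :|: G) = up F :|: up G.
Proof. exact: imsetU. Qed.

Lemma up_set1 u : up [set u] = [set lift ord0 u].
Proof. exact: imset_set1. Qed.

Lemma upD1 F u : up F :\ lift ord0 u = up (F :\ u).
Proof.
apply: setP_lift; first by rewrite !inE !ord0_up andbF.
by apply/setP => v; rewrite !(inE, mem_up) (inj_eq lift_inj0).
Qed.

Lemma upcD1 F u : upc F :\ lift ord0 u = upc (F :\ u).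
Proof.
apply: setP_lift; first by rewrite !inE eqxx neq_lift.
apply/setP => v; rewrite !(inE, mem_up) (inj_eq lift_inj0).
by rewrite [_ == ord0]eq_sym (negbTE (neq_lift _ _)).
Qed.

Lemma upcD0 F : upc F :\ ord0 = up F.
Proof. by rewrite setU1K // ord0_up. Qed.

Lemma sgn_up u F : sgn k (lift ord0 u) (up F) = sgn k u F.
Proof.
rewrite /sgn -(card_up [set _ in F | _]); congr (_ ^+ _); apply: eq_card => x.
case: (unliftP ord0 x) => [v|] ->; last by rewrite inE !ord0_up.
by rewrite mem_up !inE mem_up ltn_add2l.
Qed.

Lemma sgn_upc u F : sgn k (lift ord0 u) (upc F) = - sgn k u F.
Proof. by rewrite /upc sgnU1 ?ord0_up // sgn_set1 sgn_up mulN1r. Qed.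

Lemma sgn_ord0 E : sgn k ord0 E = 1.
Proof.
rewrite /sgn (_ : [set _ in _ | _] = set0) ?cards0 //.
by apply/setP => x; rewrite !inE andbF.
Qed.

Lemma cob_up f F : cob f (up F) = cob (fun G => f (up G)) F.
Proof.
rewrite /cob big_imset /=; last by move=> x y _ _; apply: lift_inj0.
by apply: eq_bigr => v _; rewrite sgn_up upD1.
Qed.

Lemma cob_upc f F : cob f (upc F) = f (up F) - cob (fun G => f (upc G)) F.
Proof.
rewrite /cob big_setU1 ?ord0_up //= sgn_ord0 mul1r upcD0; congr (_ + _).
rewrite -sumrN big_imset /=; last by move=> x y _ _; apply: lift_inj0.
by apply: eq_bigr => v _; rewrite sgn_upc upcD1 mulNr.
Qed.

Lemma sum_up_upc (W : nmodType) (h : {set 'I_n.+1} -> W) :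
  \sum_E h E = \sum_F h (up F) + \sum_F h (upc F).
Proof.
rewrite (bigID (fun E : {set 'I_n.+1} => ord0 \in E)) /= addrC; congr (_ + _).
  rewrite (reindex_onto up down) /=; last first.
    by move=> E /negbTE E0; rewrite {2}(downK E) E0.
  by apply: eq_bigl => F; rewrite ord0_up upK eqxx.
rewrite (reindex_onto upc down) /=; last by move=> E E0; rewrite {2}(downK E) E0.
by apply: eq_bigl => F; rewrite ord0_upc upcK eqxx.
Qed.

(* [X] is the union of [L] and of the cone over its subcomplex [M]. *)
Variables (L M : {set {set 'I_n}}) (X : {set {set 'I_n.+1}}).
Hypotheses (ML : M \subset L).
Hypotheses (XL : forall F, (up F \in X) = (F \in L)).
Hypotheses (XM : forall F, (upc F \in X) = (F \in M)).

Lemma cocycle_up j f : cocycle X j f -> cocycle L j (fun F => f (up F)).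
Proof. by move=> fX K KL Kj; rewrite -cob_up fX ?XL ?card_up. Qed.

(** At the cone over [K] a coboundary is the value at [K] minus the coboundary
    of the restriction to the cone. *)
Lemma cocycle_upc j f : cocycle X j.+1 f ->
  (forall F, F \in L -> #|F| = j.+1 -> f (up F) = 0) ->
  cocycle M j (fun F => f (upc F)).
Proof.
move=> fX f0 K KM Kj; have := fX (upc K); rewrite XM card_upc Kj cob_upc.
by rewrite f0 // ?(subsetP ML) // sub0r => /(_ KM erefl)/eqP; rewrite oppr_eq0 => /eqP.
Qed.

(** A primitive on [M], extended to the cone and by zero to [L], is a primitive
    up to sign. *)
Lemma coexact_cone j f :
  (forall F, F \in L -> #|F| = j -> f (up F) = 0) ->
  (if j is j'.+1 then coexact M j' (fun F => f (upc F)) else True) ->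
  coexact X j f.
Proof.
move=> f0 fM; case: j f0 fM => [|j] f0 fM.
  exists (fun _ => 0); elim/up_upc_ind => F; rewrite ?card_upc // XL card_up => FL F0.
  by rewrite f0 // /cob big1 // => v _; rewrite mulr0.
have [g gE] := fM.
exists (fun E => if ord0 \in E then - g (down E) else 0); elim/up_upc_ind => F.
  rewrite XL card_up => FL Fj; rewrite f0 // cob_up /cob big1 // => v _.
  by rewrite ord0_up mulr0.
rewrite XM card_upc => FM [Fj]; rewrite cob_upc ord0_up sub0r gE // /cob -sumrN.
by apply: eq_bigr => v _; rewrite ord0_upc upcK mulrN opprK.
Qed.

Lemma coexact_lift j f : coexact L j (fun F => f (up F)) ->
  exists g, forall F, F \in L -> #|F| = j -> f (up F) - cob g (up F) = 0.
Proof.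
case=> g gE; exists (fun E => g (down E)) => F FL Fj; rewrite gE // cob_up.
by apply/eqP; rewrite subr_eq0; apply/eqP/eq_cob => v _; rewrite upK.
Qed.

Lemma coexact_addcob j f g :
  coexact X j (fun E => f E - cob g E) -> coexact X j f.
Proof.
case=> h hE; exists (fun E => 1 * h E + 1 * g E) => E EX Ej.
by rewrite cob_lin !mul1r -hE // subrK.
Qed.

Lemma cocycle_subcob j f g : cocycle X j f -> cocycle X j (fun E => f E - cob g E).
Proof.
move=> fX E EX Ej; rewrite (@eq_cob _ _ _ (fun E => 1 * f E + (-1) * cob g E)).
  by rewrite cob_lin fX // cob_cob !mulr0 addr0.
by move=> v _; rewrite mul1r mulN1r.
Qed.

Lemma coexact_cone_base j f : cocycle X j f -> coexact L j (fun F => f (up F)) ->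
  (forall j', j = j'.+1 -> coh_zero k M j') -> coexact X j f.
Proof.
move=> fX /coexact_lift [g gE] M0; apply: (@coexact_addcob _ _ g).
apply: coexact_cone => //.
case: j fX gE M0 => // j fX gE M0; apply: M0 => //.
exact: (cocycle_upc (cocycle_subcob g fX) gE).
Qed.

Lemma coh_zero_cone j : coh_zero k L j -> (forall j', j = j'.+1 -> coh_zero k M j') ->
  coh_zero k X j.
Proof.
by move=> L0 M0 f fX; apply: coexact_cone_base => //; apply/L0/cocycle_up.
Qed.

Lemma coh_le1_cone_base j : coh_le1 k L j ->
  (forall j', j = j'.+1 -> coh_zero k M j') -> coh_le1 k X j.
Proof.
move=> L1 M0 f1 f2 f1X f2X.
have [a [b [nab ab]]] := L1 _ _ (cocycle_up f1X) (cocycle_up f2X).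
by exists a, b; split=> //; apply: coexact_cone_base => //; apply: cocycle_lin.
Qed.

Lemma coh_le1_cone_apex j : coh_zero k L j.+1 -> coh_le1 k M j -> coh_le1 k X j.+1.
Proof.
move=> L0 M1 f1 f2 f1X f2X.
have [g1 g1E] := coexact_lift (L0 _ (cocycle_up f1X)).
have [g2 g2E] := coexact_lift (L0 _ (cocycle_up f2X)).
have [a [b [nab ab]]] := M1 _ _
  (cocycle_upc (cocycle_subcob g1 f1X) g1E)
  (cocycle_upc (cocycle_subcob g2 f2X) g2E).
exists a, b; split=> //.
apply: (@coexact_addcob _ _ (fun E => a * g1 E + b * g2 E)).
have E0 (E : {set 'I_n.+1}) : a * f1 E + b * f2 E - cob (fun E => a * g1 E + b * g2 E) E =
    a * (f1 E - cob g1 E) + b * (f2 E - cob g2 E).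
  by rewrite cob_lin !mulrBr opprD addrACA.
apply: coexact_cone => [F FL Fj|]; first by rewrite E0 g1E // g2E // !mulr0 addr0.
by case: ab => g gE; exists g => F FM Fj; rewrite E0 gE.
Qed.

(** The cochains on the cone over [M] can be subtracted as coboundaries, and
    what remains is the relative cohomology of [(L, M)]. *)
Lemma coh_le1_cone_rel j : downward L -> downward M ->
  rel_betti k L M j.+1 = 1%N ->
  (forall F, F \in L -> #|F| <= j.+1)%N -> (forall F, F \in M -> #|F| <= j)%N ->
  coh_le1 k X j.+1.
Proof.
move=> Lc Mc b1 Ld Md f1 f2 _ _.
pose g f E := if ord0 \in E then 0 else f (upc (down E)).
have gc f F : f (upc F) - cob (g f) (upc F) = 0.
  rewrite cob_upc /g ord0_up upK /cob big1 ?subr0 ?subrr // => v _.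
  by rewrite ord0_upc mulr0.
have B0 (c : chain_space n k) : c \in rel_boundaries k L M j.+1 -> c = 0.
  case/memv_addP=> u /memv_imgP [b bL ->] [v vM ->].
  have -> : b = 0.
    apply/ffunP => F; rewrite [RHS]ffunE; apply/eqP; apply: contraT.
    by move/(chainsP _ _ _ bL) => [/Ld]; lia.
  have -> : v = 0.
    apply/ffunP => F; rewrite [RHS]ffunE; apply/eqP; apply: contraT.
    by move/(chainsP _ _ _ vM) => [/Md]; lia.
  by rewrite linear0 addr0.
have p0 (f : {set 'I_n} -> k) : pairing f (0 : chain_space n k) = 0.
  by rewrite /pairing big1 // => F _; rewrite ffunE mulr0.
have [||||c /B0 ->|a [b [nab [h [hM hE]]]]] := @coexact_rel1 k n L M j.+1
   (fun F => f1 (up F) - cob (g f1) (up F)) (fun F => f2 (up F) - cob (g f2) (up F)) => //.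
exists a, b; split=> //.
apply: (@coexact_addcob _ _ (fun E => a * g f1 E + b * g f2 E)).
have E0 (E : {set 'I_n.+1}) : a * f1 E + b * f2 E - cob (fun E => a * g f1 E + b * g f2 E) E =
    a * (f1 E - cob (g f1) E) + b * (f2 E - cob (g f2) E).
  by rewrite cob_lin !mulrBr opprD addrACA.
exists (fun E => if ord0 \in E then 0 else h (down E)); elim/up_upc_ind => F.
  rewrite XL card_up => FL Fj; rewrite E0 hE // cob_up.
  by apply: eq_cob => v _; rewrite ord0_up upK.
rewrite XM => FM _; rewrite E0 !gc !mulr0 addr0 cob_upc ord0_up upK hM //.
by rewrite /cob big1 ?subr0 // => v _; rewrite ord0_upc mulr0.
Qed.

(** A relative cycle of [(L, M)] becomes a cycle of [X] when the cone over its
    boundary is subtracted. *)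
Lemma exists_cycle_cone j : downward L -> downward M ->
  rel_betti k L M j.+1 = 1%N ->
  exists z : {set 'I_n.+1} -> k, [/\ forall g, \sum_E z E * cob g E = 0,
    forall E, z E != 0 -> E \in X /\ #|E| = j.+1 & exists F, z (up F) != 0].
Proof.
move=> Lc Mc b1; have [c [cZ cB _]] := rel_betti1 Lc Mc ML b1.
have [cL cM] := rel_cyclesP _ _ _ _ cZ.
pose cc F : k := (c : {ffun {set 'I_n} -> k^o}) F.
pose bc F : k := (boundary_fun c : {ffun {set 'I_n} -> k^o}) F.
exists (fun E => if ord0 \in E then - bc (down E) else cc (down E)); split.
- move=> g; rewrite sum_up_upc.
  have -> : \sum_F (if ord0 \in up F then - bc (down (up F)) else cc (down (up F))) *
      cob g (up F) = pairing (cob (fun F => g (up F))) c.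
    by apply: eq_bigr => F _; rewrite ord0_up upK cob_up mulrC.
  rewrite -pairing_boundary.
  have -> : \sum_F (if ord0 \in upc F then - bc (down (upc F)) else cc (down (upc F))) *
      cob g (upc F) =
      - pairing (fun F => 1 * g (up F) + (-1) * cob (fun G => g (upc G)) F)
          (boundary_fun c).
    rewrite /pairing -sumrN; apply: eq_bigr => F _; rewrite ord0_upc upcK cob_upc.
    by rewrite mul1r mulN1r mulNr mulrC.
  rewrite pairing_lin -(pairing_boundary _ (boundary_fun c)) boundary_funK.
  rewrite mul1r [X in _ * X](_ : _ = 0) ?mulr0 ?addr0 ?subrr //.
  by rewrite /pairing big1 // => F _; rewrite ffunE mulr0.
- elim/up_upc_ind => F; rewrite ?ord0_up ?ord0_upc ?upK ?upcK ?card_up ?card_upc.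
    by rewrite XL; apply: (chainsP _ _ _ cL).
  by rewrite XM oppr_eq0 => /(chainsP _ _ _ cM) [-> ->].
- have [F cF] : exists F, cc F != 0.
    apply/existsP; apply: contraNT cB => /existsPn c0.
    suff -> : c = 0 by apply: mem0v.
    apply/ffunP => F; rewrite [RHS]ffunE; apply/eqP.
    by have := c0 F; rewrite negbK.
  by exists F; rewrite ord0_up upK.
Qed.

End Cone.

(** * Monomials, linear forms and homogeneous parts *)

Section Monomials.
Variables (k : fieldType) (N : nat).
Local Notation S := {mpoly k[N]}.
Implicit Types (m : 'X_{1..N}) (f g : S) (A B F G K : {set 'I_N}) (e : 'I_N -> k).

Definition msupport m : {set 'I_N} := [set u | m u != 0%N].

Lemma msupport0 : msupport 0%MM = set0.
Proof. by apply/setP => u; rewrite !inE mnm0E. Qed.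

Lemma msupportD m1 m2 : msupport (m1 + m2) = msupport m1 :|: msupport m2.
Proof. by apply/setP => u; rewrite !inE mnmDE addn_eq0 negb_and. Qed.

Lemma msupportU u : msupport U_(u) = [set u].
Proof. by apply/setP => v; rewrite !inE mnm1E eqb0 negbK eq_sym. Qed.

Lemma msupport_eq0 m : (msupport m == set0) = (mdeg m == 0%N).
Proof.
rewrite mdeg_eq0; apply/eqP/eqP => [/setP m0|->]; last exact: msupport0.
by apply/mnmP => u; have := m0 u; rewrite !inE mnm0E => /negbFE/eqP.
Qed.

Lemma mnm_ind (P : 'X_{1..N} -> Prop) :
  P 0%MM -> (forall u m, P m -> P (U_(u) + m)%MM) -> forall m, P m.
Proof.
move=> P0 PU m; move: {2}(mdeg m) (erefl (mdeg m)) => c.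
elim: c m => [|c IH] m mc; first by move/eqP: mc; rewrite mdeg_eq0 => /eqP ->.
have /set0Pn [u] : msupport m != set0 by rewrite msupport_eq0 mc.
rewrite inE -lep1mP => um; rewrite -(submK um) addmC; apply: PU; apply: IH.
by move: mc; rewrite -{1}(submK um) mdegD mdeg1 addn1 => -[].
Qed.

Lemma mpoly_ring_ind (P : S -> Prop) : (forall c, P c%:MP) ->
  (forall f g, P f -> P g -> P (f + g)) -> (forall f g, P f -> P g -> P (f * g)) ->
  (forall u, P 'X_u) -> forall f, P f.
Proof.
move=> PC PD PM PX f; rewrite (mpolyE f); elim/big_rec: _ => [|m g _ Pg].
  by rewrite -mpolyC0.
apply: PD => //; rewrite -mul_mpolyC; apply: (PM _ _ (PC _)).
elim/mnm_ind: m => [|u m Pm]; first by rewrite mpolyX0 -mpolyC1.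
by rewrite mpolyXD; apply: PM.
Qed.

Lemma mcoeffM_neq0 f g m : (f * g)@_m != 0 ->
  exists m1 m2, [/\ m = (m1 + m2)%MM, f@_m1 != 0 & g@_m2 != 0].
Proof.
rewrite mcoeffM => H.
have /existsP [[m1 m2] /andP [/eqP mE fg]] :
    [exists q : 'X_{1..N < (mdeg m).+1, (mdeg m).+1},
      (m == (q.1 + q.2)%MM) && (f@_(q.1) * g@_(q.2) != 0)].
  apply: contraNT H => /existsPn H; apply/eqP/big1 => q mq; apply/eqP.
  by have := H q; rewrite mq negbK.
by exists m1, m2; split; [|apply: contraNneq fg => ->; rewrite mul0r
  |apply: contraNneq fg => ->; rewrite mulr0].
Qed.

Lemma mcoeffD_neq0 f g m : (f + g)@_m != 0 -> f@_m != 0 \/ g@_m != 0.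
Proof.
rewrite mcoeffD; have [->|] := eqVneq f@_m 0; last by left.
by rewrite add0r; right.
Qed.

Lemma mcoeffX_neq0 m m' : ('X_[m] : S)@_m' != 0 -> m = m'.
Proof. by rewrite mcoeffX; apply: contra_neq_eq => /negbTE ->. Qed.

Definition lin e : S := \sum_u e u *: 'X_u.

Lemma mcoeff_lin e m : (lin e)@_m = \sum_u e u * (U_(u)%MM == m)%:R.
Proof. by rewrite /lin raddf_sum; apply: eq_bigr => u _; rewrite /= mcoeffZ mcoeffX. Qed.

Lemma mcoeff_linU e u : (lin e)@_U_(u) = e u.
Proof.
rewrite mcoeff_lin (bigD1 u) //= eqxx mulr1 big1 ?addr0 // => v nv.
by rewrite eq_mnm1 (negbTE nv) mulr0.
Qed.

Lemma mcoeff_lin_neq0 e m : (lin e)@_m != 0 -> exists2 u, m = U_(u)%MM & e u != 0.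
Proof.
move=> H; have /existsP [u /eqP um] : [exists u, U_(u)%MM == m].
  apply: contraNT H => /existsPn H; rewrite mcoeff_lin; apply/eqP/big1 => u _.
  by rewrite (negbTE (H u)) mulr0.
by exists u; rewrite // -mcoeff_linU um.
Qed.

Lemma eq_lin e e' : e =1 e' -> lin e = lin e'.
Proof. by move=> ee; apply: eq_bigr => u _; rewrite ee. Qed.

Lemma lin0 : lin (fun _ => 0) = 0.
Proof. by rewrite /lin big1 // => u _; rewrite scale0r. Qed.

Lemma linB e e' : lin (fun u => e u - e' u) = lin e - lin e'.
Proof. by rewrite /lin -sumrB; apply: eq_bigr => u _; rewrite scalerBl. Qed.

Lemma lin_sum (I : finType) (P : pred I) (x : I -> k) (e : I -> 'I_N -> k) :
  lin (fun u => \sum_(i | P i) x i * e i u) = \sum_(i | P i) x i *: lin (e i).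
Proof.
rewrite /lin; under [RHS]eq_bigr => i _ do rewrite scaler_sumr.
rewrite exchange_big; apply: eq_bigr => u _; rewrite scaler_suml.
by apply: eq_bigr => i _; rewrite scalerA.
Qed.

Lemma lin_delta u : lin (fun v => (v == u)%:R) = 'X_u.
Proof.
rewrite /lin (bigD1 u) //= eqxx scale1r big1 ?addr0 // => v /negbTE ->.
by rewrite scale0r.
Qed.

Lemma meval_lin e p : (lin e).@[p] = \sum_u e u * p u.
Proof. by rewrite /lin raddf_sum; apply: eq_bigr => u _; rewrite /= mevalZ mevalXU. Qed.

Lemma lin_homog e : lin e \is 1.-homog.
Proof. by apply: rpred_sum => u _; apply: dhomogZ; rewrite dhomogX; apply/eqP/mdeg1. Qed.

Lemma mcoeff_pihomog i f m : (pihomog mdeg i f)@_m = if mdeg m == i then f@_m else 0.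
Proof.
rewrite pihomogE raddf_sum /=.
under eq_bigr => m' _ do rewrite mcoeffZ mcoeffX.
have [mf|mf] := boolP ((m \in msupp f) && (mdeg m == i)).
  case/andP: mf => mf mi; rewrite mi -big_filter.
  rewrite (bigD1_seq m) ?filter_uniq ?msupp_uniq ?mem_filter ?mi //=.
  rewrite eqxx mulr1; by rewrite big1 ?addr0 // => m' /negbTE ->; rewrite mulr0.
rewrite big_seq_cond big1 => [|m' /andP [m'f m'i]]; last first.
  case: eqP => [E|]; rewrite ?mulr0 //.
  by move: mf; rewrite -E m'f m'i.
by case: ifP mf => // _; rewrite andbT => /memN_msupp_eq0 ->.
Qed.

Lemma pihomog_mul_lin0 f e : pihomog mdeg 0 (f * lin e) = 0.
Proof.
apply/mpolyP => m; rewrite mcoeff_pihomog mcoeff0; case: eqP => // m0.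
apply/eqP; apply: contraT => /mcoeffM_neq0 [m1 [m2 [mE _ /mcoeff_lin_neq0 [u m2E _]]]].
by move: (mdegD m1 m2); rewrite -mE [mdeg m]m0 m2E mdeg1 addn1.
Qed.

Lemma pihomog_mul i j f g : g \is j.-homog ->
  pihomog mdeg (i + j) (f * g) = pihomog mdeg i f * g.
Proof.
move=> gj; rewrite {1}(mpolyE f) mulr_suml raddf_sum pihomogE mulr_suml.
rewrite [RHS]big_mkcond; apply: eq_bigr => m _ /=.
have mg : f@_m *: 'X_[m] * g \is (mdeg m + j).-homog.
  by apply: dhomogM => //; apply: dhomogZ; rewrite dhomogX.
case: eqP => mi; first by rewrite pihomog_dE // -mi.
by rewrite (pihomog_ne0 _ mg) // eqn_add2r; apply/eqP.
Qed.

Lemma pihomog_mul_lin i f e :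
  pihomog mdeg i.+1 (f * lin e) = pihomog mdeg i f * lin e.
Proof. by rewrite -addn1 pihomog_mul ?lin_homog. Qed.

Lemma homog_coeff i f m : f \is i.-homog -> f@_m != 0 -> mdeg m = i.
Proof. by move=> fi; apply: contraNeq; move/(dhomog_nemf_coeff fi) ->. Qed.

Lemma mpoly_homog_ind i (P : S -> Prop) : P 0 -> (forall f g, P f -> P g -> P (f + g)) ->
  (forall c m, mdeg m = i -> P (c *: 'X_[m])) -> forall f, f \is i.-homog -> P f.
Proof.
move=> P0 PD PX f fi; rewrite (mpolyE f) big_seq.
elim/big_rec: _ => // m g mf Pg; apply: PD => //; apply: PX.
by apply: (homog_coeff fi); rewrite -mcoeff_msupp.
Qed.

End Monomials.

(** * Star ideals and elimination of variables *)

Section FaceRing.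
Variables (k : fieldType) (N : nat) (Gamma : {set {set 'I_N}}) (th : nat -> 'I_N -> k).
Local Notation S := {mpoly k[N]}.
Implicit Types (m : 'X_{1..N}) (f g h : S) (A B F G H K : {set 'I_N}) (e : 'I_N -> k).
Hypothesis Gamma_down : downward Gamma.

(** The ideal of the star of [G]: the span of the monomials whose support does
    not lie in a face containing [G].  For [G = set0] this is the face ideal. *)
Definition nonstar G f := forall m, msupport m :|: G \in Gamma -> f@_m = 0.

Lemma nonstar0 G : nonstar G 0.
Proof. by move=> m _; rewrite mcoeff0. Qed.

Lemma nonstarD G f g : nonstar G f -> nonstar G g -> nonstar G (f + g).
Proof. by move=> hf hg m mG; rewrite mcoeffD hf // hg // addr0. Qed.

Lemma nonstarM G f g : nonstar G f -> nonstar G (g * f).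
Proof.
move=> hf m mG; apply/eqP; apply: contraT => /mcoeffM_neq0 [m1 [m2 [mE _ /eqP []]]].
apply: hf; apply: Gamma_down mG _.
by rewrite mE msupportD setSU // subsetUr.
Qed.

Lemma nonstarS G H f : G \subset H -> nonstar G f -> nonstar H f.
Proof.
move=> GH hf m mH; apply: hf; apply: Gamma_down mH _; exact: setUS.
Qed.

Lemma nonstarX G m : msupport m :|: G \notin Gamma -> nonstar G 'X_[m].
Proof.
move=> mG m'; rewrite mcoeffX; case: eqP => // <- mG'.
by rewrite mG' in mG.
Qed.

Lemma nonstar_pihomog G i f : nonstar G f -> nonstar G (pihomog mdeg i f).
Proof. by move=> hf m mG; rewrite mcoeff_pihomog hf // if_same. Qed.

Lemma nonstar_var G u f : nonstar (u |: G) f -> nonstar G ('X_u * f).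
Proof.
move=> hf m mG; apply/eqP; apply: contraT => /mcoeffM_neq0.
case=> m1 [m2 [mE /mcoeffX_neq0 m1E /eqP []]].
apply: hf; move: mG; rewrite mE -m1E msupportD msupportU.
by rewrite setUAC setUC.
Qed.

(** The polynomial ring modulo this ideal is the face ring of the star of [G]
    modulo the first [r] forms. *)
Definition istar G r f :=
  exists h : nat -> S, nonstar G (f - \sum_(i < r) h i * lin (th i)).

Lemma nonstar_istar G r f : nonstar G f -> istar G r f.
Proof.
move=> hf; exists (fun _ => 0); rewrite big1 ?subr0 // => i _; exact: mul0r.
Qed.

Lemma istar0 G r : istar G r 0.
Proof. exact/nonstar_istar/nonstar0. Qed.

Lemma istarD G r f g : istar G r f -> istar G r g -> istar G r (f + g).
Proof.
case=> h1 H1 [h2 H2]; exists (fun i => h1 i + h2 i).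
under eq_bigr => i _ do rewrite mulrDl.
by rewrite big_split /= opprD addrACA; apply: nonstarD.
Qed.

Lemma istarM G r f g : istar G r f -> istar G r (g * f).
Proof.
case=> h H; exists (fun i => g * h i).
under eq_bigr => i _ do rewrite -mulrA.
by rewrite -mulr_sumr -mulrBr; apply: nonstarM.
Qed.

Lemma istarMr G r f g : istar G r f -> istar G r (f * g).
Proof. by rewrite mulrC; apply: istarM. Qed.

Lemma istarZ G r c f : istar G r f -> istar G r (c *: f).
Proof. by rewrite -mul_mpolyC; apply: istarM. Qed.

Lemma istarN G r f : istar G r f -> istar G r (- f).
Proof. by rewrite -scaleN1r; apply: istarZ. Qed.

Lemma istarB G r f g : istar G r f -> istar G r g -> istar G r (f - g).
Proof. by move=> hf hg; apply: istarD => //; apply: istarN. Qed.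

Lemma istar_sum G r (I : Type) (s : seq I) (P : pred I) (F : I -> S) :
  (forall i, P i -> istar G r (F i)) -> istar G r (\sum_(i <- s | P i) F i).
Proof. by move=> hF; apply: big_ind => //; [apply: istar0 | apply: istarD]. Qed.

Lemma istar_trans G r f g : istar G r (f - g) -> istar G r g -> istar G r f.
Proof. by move=> fg hg; rewrite -(subrK g f); apply: istarD. Qed.

Lemma istarS G H r f : G \subset H -> istar G r f -> istar H r f.
Proof. by move=> GH [h hh]; exists h; apply: nonstarS hh. Qed.

Lemma istar_row G r i : (i < r)%N -> istar G r (lin (th i)).
Proof.
move=> ir; exists (fun j => (j == i)%:R).
rewrite (bigD1 (Ordinal ir)) //= eqxx mul1r big1 ?addr0 ?subrr => [|j nj].
  exact: nonstar0.
case: eqP => [E|]; rewrite ?mul0r //; case/eqP: nj; exact: val_inj.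
Qed.

Lemma istar_leq G r s f : (r <= s)%N -> istar G r f -> istar G s f.
Proof.
move=> rs [h hh]; apply: (istar_trans (g := \sum_(i < r) h i * lin (th i))).
  exact: nonstar_istar.
by apply: istar_sum => i _; apply/istarM/istar_row/(leq_trans _ rs).
Qed.

Lemma istar_row_span G r e : row_span th r e -> istar G r (lin e).
Proof.
case=> c cE; rewrite (eq_lin cE) lin_sum.
by apply: istar_sum => i _; apply/istarZ/istar_row.
Qed.

Lemma istarS_inv G r f : istar G r.+1 f -> exists h, istar G r (f - h * lin (th r)).
Proof.
case=> h; rewrite big_ord_recr /= => H; exists (h r); exists h.
by rewrite addrAC -addrA -opprD.
Qed.

Lemma istar_var G r u f : istar (u |: G) r f -> istar G r ('X_u * f).
Proof.
case=> h /nonstar_var H; exists (fun i => 'X_u * h i).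
by move: H; rewrite mulrBr mulr_sumr; under eq_bigr => i _ do rewrite mulrA.
Qed.

Lemma istar_pihomog G r i f : istar G r f -> istar G r (pihomog mdeg i f).
Proof.
case=> h /(nonstar_pihomog i) H.
exists (fun j => if i is i'.+1 then pihomog mdeg i' (h j) else 0).
suff <- : pihomog mdeg i (\sum_(j < r) h j * lin (th j)) =
  \sum_(j < r) (if i is i'.+1 then pihomog mdeg i' (h j) else 0) * lin (th j).
  by rewrite -pihomogB.
rewrite raddf_sum /=; apply: eq_bigr => j _.
by case: i {H} => [|i]; rewrite ?pihomog_mul_lin0 ?mul0r // pihomog_mul_lin.
Qed.

(** Taking homogeneous parts of a reduction makes the multiplier of the new
    form homogeneous. *)
Lemma istarS_homog G r i f : f \is i.+1.-homog -> istar G r.+1 f ->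
  exists2 u, u \is i.-homog & istar G r (f - u * lin (th r)).
Proof.
move=> fi /istarS_inv [h /(istar_pihomog i.+1)].
rewrite linearB /= pihomog_mul_lin pihomog_dE // => H.
by exists (pihomog mdeg i h); first exact: pihomogP.
Qed.

Lemma istarS_homog0 G r f : f \is 0.-homog -> istar G r.+1 f -> istar G r f.
Proof.
move=> f0 /istarS_inv [h /(istar_pihomog 0)].
by rewrite linearB /= pihomog_mul_lin0 subr0 pihomog_dE.
Qed.

Lemma istar_homog_parts G r f : (forall i, istar G r (pihomog mdeg i f)) -> istar G r f.
Proof.
move=> H; rewrite (pihomog_partitionE (leqnn (msize f))).
by apply: istar_sum.
Qed.

Section Eliminate.
Variables (r : nat) (K : {set 'I_N}).
Hypothesis K_minor : minor th r K != 0.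

Lemma dual_forms : exists e : 'I_N -> 'I_N -> k, forall v, v \in K ->
  row_span th r (e v) /\ forall u, u \in K -> e v u = (u == v)%:R.
Proof.
have /fin_all_exists [e eP] : forall v : 'I_N, exists e : 'I_N -> k, v \in K ->
    row_span th r e /\ forall u, u \in K -> e u = (u == v)%:R.
  move=> v; case: (boolP (v \in K)) => [vK|_]; last by exists (fun _ => 0).
  by have [e es ee] := dual_form K_minor vK; exists e.
by exists e.
Qed.

(** Solving the first [r] linear forms for the variables in [K] gives a
    substitution that kills these forms and is the identity modulo them. *)
Lemma exists_elimination : exists s : {rmorphism S -> S}, [/\
  [/\ forall f, istar set0 r (f - s f),
      forall c f, s (c *: f) = c *: s f,
      forall G f, K \subset G -> istar G r f -> nonstar G (s f) &
      forall G f, K \subset G -> nonstar G (s f) -> istar G r f],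
  forall i f, f \is i.-homog -> s f \is i.-homog,
  forall f m, (s f)@_m != 0 -> [disjoint msupport m & K] &
  exists2 e, row_span th r e & s (lin (th r)) = lin (fun u => th r u - e u) /\
    {in K, forall u, th r u - e u = 0}].
Proof.
have [e eP] := dual_forms.
(* [img] is the value of the variables, and [red] the effect on forms. *)
pose img u : S := if u \in K then 'X_u - lin (e u) else 'X_u.
pose s : {rmorphism S -> S} := mmap (@mpolyC N k) img.
pose red (a : 'I_N -> k) u : k := a u - \sum_(v in K) a v * e v u.
have sX u : s 'X_u = img u by rewrite [LHS]mmapX mmap1U.
have sC c : s c%:MP = c%:MP by rewrite [LHS]mmapC.
have sZ c f : s (c *: f) = c *: s f by rewrite -!mul_mpolyC rmorphM /= sC.
have imgK u m : (img u)@_m != 0 -> exists2 w, m = U_(w)%MM & w \notin K.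
  rewrite /img; case: ifPn => uK.
    rewrite -{1}lin_delta -linB => /mcoeff_lin_neq0 [w -> ew]; exists w => //.
    by apply: contra ew => wK; rewrite (eP u uK).2 // subrr.
  by move/mcoeffX_neq0 => <-; exists u.
have imgE u : 'X_u - img u = if u \in K then lin (e u) else 0.
  by rewrite /img; case: ifP => _; rewrite ?subrr // subKr.
have s_id f : istar set0 r (f - s f).
  elim/mpoly_ring_ind: f => [c|f g hf hg|f g hf hg|u].
  - by rewrite sC subrr; apply: istar0.
  - have -> : f + g - s (f + g) = (f - s f) + (g - s g).
      by rewrite rmorphD opprD addrACA.
    exact: istarD.
  - have -> : f * g - s (f * g) = f * (g - s g) + (f - s f) * s g.
      by rewrite rmorphM /= mulrBr mulrBl addrA subrK.
    by apply: istarD; [apply: istarM | apply: istarMr].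
  - rewrite sX imgE; case: ifP => uK; last exact: istar0.
    by apply: istar_row_span; case: (eP u uK).
have s_lin a : s (lin a) = lin (red a).
  rewrite /lin rmorph_sum /=.
  have -> : \sum_u red a u *: 'X_u = lin a - \sum_(v in K) a v *: lin (e v).
    by rewrite -lin_sum -linB.
  rewrite /lin [X in _ - X]big_mkcond -sumrB; apply: eq_bigr => u _.
  rewrite sZ sX -[img u](subKr 'X_u) imgE scalerBr; congr (_ - _).
  by case: ifP; rewrite ?scaler0.
have redK a : {in K, forall u, red a u = 0}.
  move=> u uK; rewrite /red (bigD1 u) //= (eP u uK).2 // eqxx mulr1 big1 ?addr0 ?subrr //.
  by move=> v /andP [vK nvu]; rewrite (eP v vK).2 // eq_sym (negbTE nvu) mulr0.
have red_span i : row_span th r (fun u => \sum_(v in K) th i v * e v u).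
  by apply: row_span_sum => v vK; case: (eP v vK).
have s_row i : (i < r)%N -> s (lin (th i)) = 0.
  move=> ir; rewrite s_lin -lin0; apply: eq_lin.
  apply: (row_span_vanish K_minor _ (redK _)).
  by apply: row_spanB => //; apply: row_span_row.
have s_mon m m' : (s 'X_[m])@_m' != 0 -> msupport m :\: K \subset msupport m'.
  elim/mnm_ind: m m' => [|u m IH] m'; first by rewrite msupport0 set0D sub0set.
  rewrite mpolyXD rmorphM sX msupportD msupportU setDUl subUset.
  case/mcoeffM_neq0 => m1 [m2 [-> im1 /IH sm2]]; rewrite msupportD.
  rewrite (subset_trans sm2) ?subsetUr // andbT.
  have [uK|uK] := boolP (u \in K); first by rewrite (_ : [set u] :\: K = set0) ?sub0set //;
    apply/setP => x; rewrite !inE; case: eqP => [->|]; rewrite ?uK ?andbF.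
  move: im1; rewrite /img (negbTE uK) => /mcoeffX_neq0 <-.
  by rewrite msupportU (subset_trans (subsetDl _ _)) ?subsetUl.
have s_nonstar G f : K \subset G -> nonstar G f -> nonstar G (s f).
  move=> KG hf; rewrite (mpolyE f) rmorph_sum big_seq.
  apply: big_ind; [exact: nonstar0 | exact: nonstarD | move=> m mf m' m'G].
  rewrite sZ mcoeffZ; apply/eqP; rewrite mulf_eq0 -[_ || _]negbK negb_or; apply/negP.
  case/andP=> fm /s_mon sm; case/eqP: fm; apply: hf; apply: Gamma_down m'G _.
  rewrite subUset subsetUr andbT; apply/subsetP => u um.
  have [uG|uG] := boolP (u \in G); first by rewrite inE uG orbT.
  rewrite inE (subsetP sm) // inE um andbT; apply: contra uG; exact: (subsetP KG).
exists s; split=> //.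
- split=> // G f KG.
    case=> h /(s_nonstar _ _ KG); rewrite rmorphB rmorph_sum /=.
    by rewrite big1 ?subr0 // => i _; rewrite rmorphM /= s_row // mulr0.
  move=> hs; apply: (istar_trans (g := s f)); last exact: nonstar_istar.
  exact: istarS (sub0set _) (s_id f).
- move=> i f; apply: (@mpoly_homog_ind _ _ i (fun f => s f \is i.-homog)).
  + by rewrite rmorph0 dhomog0.
  + move=> g h hg hh; have -> : s (g + h) = s g + s h by rewrite rmorphD.
    exact: dhomogD.
  + move=> c m <-; rewrite sZ dhomogZ //; elim/mnm_ind: m => [|u m IH].
      by rewrite mpolyX0 rmorph1 mdeg0 dhomog1.
    rewrite mpolyXD rmorphM sX mdegD mdeg1 dhomogM //.
    apply/dhomogP => m'; rewrite mcoeff_msupp => /imgK [w -> _]; exact: mdeg1.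
- move=> f; elim/mpoly_ring_ind: f => [c|f g hf hg|f g hf hg|u] m.
  + rewrite sC mcoeffC; have [-> _|_] := eqVneq m 0%MM; last by rewrite mulr0 eqxx.
    by rewrite msupport0 -setI_eq0 set0I.
  + by rewrite rmorphD => /mcoeffD_neq0 [/hf|/hg].
  + rewrite rmorphM => /mcoeffM_neq0 [m1 [m2 [-> /hf + /hg]]].
    rewrite msupportD -!setI_eq0 setIUl setU_eq0 => -> ->; exact: isT.
  + rewrite sX => /imgK [w -> wK].
    by rewrite msupportU disjoints1.
- exists (fun u => \sum_(v in K) th r v * e v u) => //.
  by split; [rewrite s_lin | apply: redK].
Qed.

End Eliminate.
End FaceRing.

(** * The Cech complex of a star and regular sequences *)

Section Cech.
Variables (k : fieldType) (N d : nat) (Gamma : {set {set 'I_N}}).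
(* [Q] singles out the faces whose links have the homology of spheres. *)
Variables (th : nat -> 'I_N -> k) (Q : pred {set 'I_N}).
Local Notation S := {mpoly k[N]}.
Local Notation lk := (link Gamma).
Local Notation istar := (istar Gamma th).
Local Notation nonstar := (@nonstar k N Gamma).
Implicit Types (m : 'X_{1..N}) (F G H K : {set 'I_N}).

Hypothesis Gamma_down : downward Gamma.
Hypothesis Gamma_card : forall F, F \in Gamma -> (#|F| <= d)%N.
Hypothesis th_generic : generic_rows d th.
Hypothesis Q_up : forall G H, Q G -> G \subset H -> Q H.
Hypothesis Q_coh : forall G, G \in Gamma -> Q G ->
  forall j, j != (d - #|G|)%N -> coh_zero k (lk G) j.

Lemma mem_link G H : (H \in lk G) = [disjoint H & G] && (G :|: H \in Gamma).
Proof.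
rewrite !inE (setUC H) andbCA; case: disjoint => //=; apply: andb_idl => GH.
by apply: Gamma_down GH _; apply: subsetUr.
Qed.

Lemma link_card G H : G \in Gamma -> H \in lk G -> (#|H| <= d - #|G|)%N.
Proof.
move=> GG; rewrite mem_link => /andP [dHG /Gamma_card].
by rewrite cardsU setIC (eqP (_ : H :&: G == set0)) ?setI_eq0 // cards0; lia.
Qed.

Lemma link_faceU G H : H \in lk G -> G :|: H \in Gamma.
Proof. by rewrite mem_link => /andP []. Qed.

Lemma link_card_faceU G H : H \in lk G -> #|G :|: H| = (#|G| + #|H|)%N.
Proof.
rewrite mem_link => /andP [dHG _]; rewrite cardsU setIC.
by rewrite (eqP (_ : H :&: G == set0)) ?setI_eq0 // cards0 subn0.
Qed.

Lemma link_D1 G H v : H \in lk G -> H :\ v \in lk G.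
Proof.
rewrite !mem_link => /andP [dHG GH]; rewrite (disjointWl (subD1set _ _) dHG).
by apply: Gamma_down GH _; apply: setUS; apply: subD1set.
Qed.

(** For a fixed monomial the local complex is that of the faces [H] of the link
    of [G] such that the support of the monomial spans a face with [G] and [H].
    It is a cone unless the support is contained in [G]. *)
Lemma monomial_exact m G j (a : {set 'I_N} -> k) :
  (msupport m \subset G -> coh_zero k (lk G) j) ->
  (forall K, K \in lk G -> #|K| = j.+1 -> msupport m :|: (G :|: K) \in Gamma ->
     cob a K = 0) ->
  exists b, forall H, H \in lk G -> #|H| = j ->
    msupport m :|: (G :|: H) \in Gamma -> a H = cob b H.
Proof.
move=> coh aK; have [mG|] := boolP (msupport m \subset G).
  have [K KG Kj|b bE] := coh mG a.
    apply: aK => //; rewrite setUA (setUidPr mG); exact: link_faceU.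
  by exists b => H HG Hj _; apply: bE.
case/subsetPn=> w wm wG.
exists (fun H => if w \in H then 0 else sgn k w (w |: H) * a (w |: H)) => H HG Hj mH.
have [wH|wH] := boolP (w \in H).
  rewrite /cob (bigD1 w) //= setD11 setD1K // mulrA sgn_sq mul1r big1 ?addr0 //.
  by move=> v /andP [vH nvw]; rewrite !inE eq_sym nvw wH mulr0.
have := aK (w |: H); rewrite cardsU1 wH Hj add1n.
have mwH : msupport m :|: (G :|: (w |: H)) = msupport m :|: (G :|: H).
  by rewrite (setUCA G) setUCA setUC setUC; apply/setUidPr; rewrite sub1set inE wm.
have wHG : w |: H \in lk G.
  move: HG; rewrite !mem_link -!setI_eq0 setIUl setU_eq0 !setI_eq0 disjoints1 wG.
  case/andP=> -> _ /=; rewrite -mwH in mH.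
  by apply: Gamma_down mH _; apply: subsetUr.
rewrite mwH => /(_ wHG erefl mH).
rewrite /cob big_setU1 //= setU1K // => /eqP; rewrite addr_eq0 => /eqP aE.
transitivity (sgn k w (w |: H) * (sgn k w (w |: H) * a H)).
  by rewrite mulrA sgn_sq mul1r.
rewrite aE mulrN mulr_sumr -sumrN; apply: eq_bigr => v vH.
have nvw : v != w by apply: contraNneq wH => <-.
have E : (w |: H) :\ v = w |: H :\ v.
  by apply/setP => x; rewrite !inE; case: (eqVneq x w) => [->|]; rewrite // eq_sym nvw.
rewrite !inE (negbTE wH) andbF E !mulrA -mulNr; congr (_ * _).
have := @sgn_swap k N v w (w |: H).
rewrite !inE vH orbT eqxx nvw E setU1K // => /(_ isT isT isT) sw.
rewrite -[LHS]mulr1 -(sgn_sq k v H) mulrA !mulNr -mulrA.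
transitivity (- (sgn k w (w |: H) * sgn k v H) * (sgn k v (w |: H) * sgn k v H)).
  by rewrite !mulNr; congr (- _); rewrite !mulrA; congr (_ * _); rewrite mulrAC.
rewrite -sw mulrACA sgn_sq mul1r mulrC; congr (_ * _).
Qed.

Definition cobS (f : {set 'I_N} -> S) F : S := cobd (fun _ => 1) f F.

Lemma cobSE f F : cobS f F = \sum_(v in F) sgn k v F *: f (F :\ v).
Proof. by apply: eq_bigr => v _; rewrite mulr1. Qed.

Lemma mcoeff_cobS f F m : (cobS f F)@_m = cob (fun G => (f G)@_m) F.
Proof.
by rewrite cobSE raddf_sum; apply: eq_bigr => v _; rewrite /= mcoeffZ.
Qed.

Lemma cobS_cobS f F : cobS (cobS f) F = 0.
Proof. exact: cobd_sq. Qed.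

Lemma cobSB f g F : cobS (fun H => f H - g H) F = cobS f F - cobS g F.
Proof. by rewrite !cobSE -sumrB; apply: eq_bigr => v _; rewrite scalerBr. Qed.

Lemma cobSM f g F : cobS (fun H => f H * g) F = cobS f F * g.
Proof. by rewrite !cobSE mulr_suml; apply: eq_bigr => v _; rewrite scalerAl. Qed.

Lemma homog_cobS i f F : (forall H, f H \is i.-homog) -> cobS f F \is i.-homog.
Proof. by move=> hf; rewrite cobSE; apply: rpred_sum => v _; apply: dhomogZ. Qed.

(** Exactness, in degree [i] and at the faces with [j] elements of the link of
    [G], of the complex of the star rings modulo the first [r] forms. *)
Definition cech_exact G r j i := forall f : {set 'I_N} -> S,
  (forall H, f H \is i.-homog) ->
  (forall K, K \in lk G -> #|K| = j.+1 -> istar (G :|: K) r (cobS f K)) ->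
  exists g : {set 'I_N} -> S, (forall H, g H \is i.-homog) /\
    forall H, H \in lk G -> #|H| = j -> istar (G :|: H) r (f H - cobS g H).

(** The elimination of the variables of [K] identifies the star rings modulo
    [#|K|] forms with rings spanned by monomials, where exactness can be
    checked at each monomial. *)
Lemma cech_exact_base G K j i : G \in Gamma -> K \subset G ->
  (forall m, mdeg m = i -> msupport m \subset G -> [disjoint msupport m & K] ->
     coh_zero k (lk G) j) ->
  cech_exact G #|K| j i.
Proof.
move=> GG KG coh f fi fK.
have Kd : minor th #|K| K != 0.
  by apply: th_generic; apply: leq_trans (Gamma_card GG); apply: subset_leq_card.
have [s [[s_id sZ s_star _] s_homog s_vars _]] := exists_elimination Gamma_down Kd.
have s_cob H : s (cobS f H) = cobS (fun H => s (f H)) H.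
  rewrite !cobSE raddf_sum; apply: eq_bigr => v _.
  exact: sZ.
have KGH H : K \subset G :|: H by apply: subset_trans KG (subsetUl _ _).
have /fin_all_exists [b bP] : forall m : 'X_{1..N < i.+1},
    exists b : {set 'I_N} -> k, mdeg m = i -> forall H, H \in lk G -> #|H| = j ->
      msupport m :|: (G :|: H) \in Gamma -> (s (f H))@_m = cob b H.
  move=> m; have [mi|] := eqVneq (mdeg m) i; last first.
    by move=> nm; exists (fun _ => 0) => E; rewrite E eqxx in nm.
  have [dmK|dmK] := boolP [disjoint msupport m & K]; last first.
    exists (fun _ => 0) => _ H _ _ _; rewrite /cob big1 => [|v _]; last exact: mulr0.
    by apply/eqP; apply: contraR dmK => /s_vars.
  have [mG|H HG Hj mH|b bE] := @monomial_exact m G j (fun H => (s (f H))@_m).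
  - exact: coh mi mG dmK.
  - rewrite -(mcoeff_cobS (fun H => s (f H))) -s_cob.
    exact: (s_star _ _ (KGH H) (fK H HG Hj)).
  - by exists b.
exists (fun H => \sum_(m : 'X_{1..N < i.+1} | mdeg m == i) b m H *: 'X_[m]); split.
  by move=> H; apply: rpred_sum => m /eqP mi; apply: dhomogZ; rewrite dhomogX; apply/eqP.
move=> H HG Hj; apply: (istar_trans (g := s (f H) - cobS (fun H =>
    \sum_(m : 'X_{1..N < i.+1} | mdeg m == i) b m H *: 'X_[m]) H)).
  rewrite opprB addrA subrK; exact: (istarS Gamma_down (sub0set _) (s_id _)).
apply: nonstar_istar => m mH; rewrite mcoeffB mcoeff_cobS.
have [mi|mi] := eqVneq (mdeg m) i; last first.
  rewrite (dhomog_nemf_coeff (s_homog i _ (fi _))) // sub0r.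
  apply/eqP; rewrite oppr_eq0; apply/eqP; rewrite /cob big1 // => v _.
  rewrite raddf_sum big1 ?mulr0 // => m' /eqP m'i /=; rewrite mcoeffZ mcoeffX.
  rewrite (_ : (bmnm m' == m) = false) ?mulr0 //.
  by apply: contraNF mi => /eqP <-; apply/eqP.
have mb : (mdeg m < i.+1)%N by rewrite mi.
rewrite (bP (BMultinom mb)) // [X in _ - X](_ : _ = cob (b (BMultinom mb)) H) ?subrr //.
apply: eq_cob => v _; rewrite raddf_sum (bigD1 (BMultinom mb)) /= ?mi //.
rewrite mcoeffZ mcoeffX eqxx mulr1 big1 ?addr0 // => m' /andP [_ nm'].
by rewrite mcoeffZ mcoeffX; move: nm'; rewrite -val_eqE /= => /negbTE ->; rewrite mulr0.
Qed.

Definition regular G r :=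
  forall f : S, istar G r (f * lin (th r)) -> istar G r f.

(** A cocycle modulo [r.+1] forms lifts modulo [r] forms to a cochain whose
    coboundary is a multiple of the new form; by regularity the quotient is a
    cocycle, one cochain degree up and one polynomial degree down. *)
Lemma cech_exact_step G r j i : G \in Gamma -> (r < d)%N ->
  (forall K, K \in lk G -> K != set0 -> regular (G :|: K) r) ->
  cech_exact G r j i.+1 -> cech_exact G r j.+1 i -> cech_exact G r.+1 j i.+1.
Proof.
move=> GG rd reg exj exj1 f fi fK.
have /fin_all_exists [u uP] : forall K : {set 'I_N}, exists u : S, u \is i.-homog /\
    (K \in lk G -> #|K| = j.+1 -> istar (G :|: K) r (cobS f K - u * lin (th r))).
  move=> K; have [/andP [KG /eqP Kj]|nK] := boolP ((K \in lk G) && (#|K| == j.+1)).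
    have [u ui uE] := istarS_homog (homog_cobS K fi) (fK K KG Kj).
    by exists u.
  exists 0; split=> [|KG Kj]; first exact: dhomog0.
  by rewrite KG Kj eqxx in nK.
have [M MG Mj|w [wi wE]] := exj1 u (fun K => (uP K).1).
  apply: reg => //; first by rewrite -card_gt0 Mj.
  rewrite -cobSM; apply: (istar_trans (g := cobS (fun H => u H * lin (th r) - cobS f H) M)).
    by rewrite -cobSB cobSE (eq_bigr (fun v => sgn k v M *: cobS f (M :\ v))) => [|v _];
       [rewrite -cobSE cobS_cobS; apply: istar0 | rewrite opprB addrC subrK].
  rewrite cobSE; apply: istar_sum => // v vM; apply: istarZ => //.
  rewrite -opprB; apply: istarN => //.
  have Mvj : #|M :\ v| = j.+1 by move: Mj; rewrite (cardsD1 v M) vM => -[].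
  apply: istarS ((uP (M :\ v)).2 (link_D1 v MG) Mvj) => //.
  by apply: setUS; apply: subD1set.
have fwi H : f H - w H * lin (th r) \is i.+1.-homog.
  by apply: rpredB => //; rewrite -addn1; apply: dhomogM => //; apply: lin_homog.
have [K KG Kj|g [gi gE]] := exj _ fwi.
  rewrite cobSB cobSM; apply: (istar_trans (g := (u K - cobS w K) * lin (th r))).
    rewrite mulrBl opprB addrA subrK.
    exact: (uP K).2.
  by apply: istarMr => //; apply: wE.
exists g; split=> // H HG Hj.
apply: (istar_trans (g := w H * lin (th r))).
  apply: istar_leq (leqnSn r) _ => //; rewrite addrAC; exact: gE.
by apply: istarM => //; apply: istar_row.
Qed.

Lemma cech_exact_step0 G r j : cech_exact G r j 0 -> cech_exact G r.+1 j 0.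
Proof.
move=> ex f fi fK; have [K KG Kj|g [gi gE]] := ex f fi.
  by apply: istarS_homog0 (fK K KG Kj); apply: homog_cobS.
by exists g; split=> // H HG Hj; apply: istar_leq (gE H HG Hj).
Qed.

(** For [r = #|G|] the variables of [G] are eliminated, and only the constant
    monomial sees the cohomology of the link.  Each further form moves it one
    step along the antidiagonal [i + j = d - #|G|]. *)
Lemma cech_exact_big G r j i : G \in Gamma -> Q G -> (#|G| <= r <= d)%N ->
  (forall K s, K \in lk G -> K != set0 -> (s < d)%N -> regular (G :|: K) s) ->
  (i + j != d - #|G|)%N || (r < #|G| + i)%N -> cech_exact G r j i.
Proof.
move=> GG QG; elim: r j i => [|r IH] j i /andP [Gr rd] reg ij.
  have G0 : G = set0 by apply/eqP; rewrite -cards_eq0 -leqn0.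
  have := @cech_exact_base G G j i GG (subxx _).
  rewrite (_ : #|G| = 0%N); last by rewrite G0 cards0.
  apply.
  move=> m mi mG _; apply: Q_coh => //.
  have i0 : i = 0%N by apply/eqP; rewrite -mi -msupport_eq0 -subset0 -G0.
  by move: ij; rewrite i0 G0 cards0 addn0 ltnn orbF.
move: Gr; rewrite leq_eqVlt => /orP [/eqP Gr|Gr].
  rewrite -Gr; apply: cech_exact_base => // m mi mG.
  rewrite -setI_eq0 (setIidPl mG) msupport_eq0 mi => /eqP i0.
  apply: Q_coh => //; move: ij; rewrite i0; lia.
case: i ij => [|i] ij.
  by apply: cech_exact_step0; apply: IH => //; lia.
apply: cech_exact_step => //; first by move=> K KG K0; apply: reg.
  by apply: IH => //; lia.
by apply: IH => //; lia.
Qed.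

Lemma cech_exact_small G r j i : G \in Gamma -> Q G -> (r <= #|G|)%N ->
  j != (d - #|G|)%N -> cech_exact G r j i.
Proof.
move=> GG QG rG jd.
have [K KG Kr] : exists2 K : {set 'I_N}, K \subset G & #|K| = r.
  have /card_gt0P [K] : (0 < #|[set K : {set 'I_N} | K \subset G & #|K| == r]|)%N.
    by rewrite cards_draws bin_gt0.
  by rewrite inE => /andP [KG /eqP Kr]; exists K.
by rewrite -Kr; apply: cech_exact_base => // m _ _ _; apply: Q_coh.
Qed.

Lemma set0_link G : G \in Gamma -> set0 \in lk G.
Proof. by move=> GG; rewrite mem_link setU0 GG -setI_eq0 set0I eqxx. Qed.

(** This is exactness at the empty face of the link, for a constant family. *)
Lemma istar_local G r i f : G \in Gamma -> cech_exact G r 0 i -> f \is i.-homog ->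
  (forall v, v \notin G -> v |: G \in Gamma -> istar (v |: G) r f) -> istar G r f.
Proof.
move=> GG ex fi fv; have [K KG /eqP/cards1P [v Kv]|g [_ gE]] := ex (fun _ => f) (fun _ => fi).
  move: KG; rewrite Kv mem_link disjoints1 setUC => /andP [vG vGG].
  by rewrite cobSE big_set1; apply: istarZ => //; apply: fv.
have := gE set0 (set0_link GG) (cards0 _).
by rewrite setU0 cobSE big_set0 subr0.
Qed.

(** The star ring of a facet is a polynomial ring, hence a domain. *)
Lemma facet_regular F r : F \in Gamma -> #|F| = d -> (r < d)%N -> regular F r.
Proof.
move=> FG Fd rd f frF.
have [K KF Kr] : exists2 K : {set 'I_N}, K \subset F & #|K| = r.
  have /card_gt0P [K] : (0 < #|[set K : {set 'I_N} | K \subset F & #|K| == r]|)%N.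
    by rewrite cards_draws bin_gt0 Fd ltnW.
  by rewrite inE => /andP [KF /eqP Kr]; exists K.
have Kd : minor th r K != 0 by rewrite -Kr; apply: th_generic; rewrite Kr ltnW.
have [s [[s_id sZ s_star s_star'] _ _ [e es [se eK]]]] := exists_elimination Gamma_down Kd.
apply: s_star' => //; move: (s_star _ _ KF frF); rewrite rmorphM /= se.
set a := fun u => _; set q := s f.
(* [rho] sets the variables outside [F] to zero. *)
pose rho : {rmorphism S -> S} :=
  mmap (@mpolyC N k) (fun u => if u \in F then 'X_u else 0 : S).
have rhoX m : rho 'X_[m] = if msupport m \subset F then 'X_[m] else 0.
  elim/mnm_ind: m => [|u m IH]; first by rewrite mpolyX0 rmorph1 msupport0 sub0set.
  rewrite mpolyXD rmorphM IH /= msupportD msupportU subUset sub1set.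
  rewrite [rho 'X_u]mmapX mmap1U; case: (u \in F); rewrite ?mul0r //=.
  by case: ifP; rewrite ?mulr0.
have rho_sum g : rho g =
    \sum_(m <- msupp g) (if msupport m \subset F then g@_m *: 'X_[m] else 0).
  rewrite {1}(mpolyE g) rmorph_sum; apply: eq_bigr => m _.
  rewrite -[X in rho X]mul_mpolyC rmorphM /= rhoX [rho _]mmapC mul_mpolyC.
  by case: ifP => // _; rewrite scaler0.
have rhoE g m : (rho g)@_m = if msupport m \subset F then g@_m else 0.
  rewrite rho_sum raddf_sum /=; case: ifP => mF.
    rewrite [in RHS](mpolyE g) raddf_sum; apply: eq_bigr => m' _ /=.
    case: ifPn => // m'F; rewrite mcoeff0 mcoeffZ mcoeffX.
    by case: eqP m'F => [->|]; rewrite ?mF ?mulr0.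
  apply: big1 => m' _; case: ifP => [m'F|_]; last exact: mcoeff0.
  by rewrite mcoeffZ mcoeffX; case: eqP m'F => [->|]; rewrite ?mF ?mulr0.
have nonstar_rho g : nonstar F g <-> rho g = 0.
  split=> [hg|/mpolyP hg m mF].
    apply/mpolyP => m; rewrite rhoE mcoeff0; case: ifP => // mF; apply: hg.
    by rewrite (setUidPr mF).
  have := hg m; rewrite rhoE mcoeff0.
  have -> // : msupport m \subset F.
  apply/setUidPr/esym/eqP; rewrite eqEcard subsetUr Fd; exact: Gamma_card.
move/nonstar_rho; rewrite rmorphM => /eqP; rewrite mulf_eq0 => /orP [|].
  by move=> /eqP /nonstar_rho.
have [w wF wK] : exists2 w, w \in F & w \notin K.
  apply/subsetPn; apply/negP => /subset_leq_card; rewrite Fd Kr; lia.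
move/eqP/mpolyP => /(_ U_(w)%MM); rewrite rhoE mcoeff0 msupportU sub1set wF mcoeff_linU.
move/eqP; rewrite (negbTE (reduced_row_neq0 es wK eK _)) //.
have -> : r.+1 = #|w |: K| by rewrite cardsU1 wK Kr.
by apply: th_generic; rewrite cardsU1 wK Kr.
Qed.

(** Exactness of the complex embeds the star ring of [G] modulo the first [r]
    forms into those of larger faces; this reduces the claim to facets. *)
Lemma star_regular G r : G \in Gamma -> Q G -> (r < d)%N -> regular G r.
Proof.
move: {2}(d - #|G|)%N (erefl (d - #|G|)%N) => e.
elim/ltn_ind: e G r => e IH G r dG GG QG rd.
have Gd := Gamma_card GG.
have reg K s : K \in lk G -> K != set0 -> (s < d)%N -> regular (G :|: K) s.
  move=> KG K0 sd; apply: (IH (d - #|G :|: K|)%N) => //.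
  - have := Gamma_card (link_faceU KG); rewrite (link_card_faceU KG) -dG.
    by move: K0; rewrite -card_gt0; lia.
  - exact: link_faceU.
  - by apply: Q_up QG _; apply: subsetUl.
have [Gd'|Gd'] := eqVneq #|G| d; first exact: facet_regular.
move=> f frG; apply: istar_homog_parts => // i.
apply: (istar_local (i := i)) => //; last 1 first.
- move=> v vG vGG; have /reg : [set v] \in lk G.
    by rewrite mem_link disjoints1 vG setUC.
  move/(_ r); rewrite setUC; apply=> //; first by rewrite -card_gt0 cards1.
  rewrite -pihomog_mul_lin; apply: istar_pihomog => //.
  by apply: istarS frG => //; apply: subsetUr.
- case: (leqP #|G| r) => Gr; last first.
    by apply: cech_exact_small => //; [apply: ltnW | lia].
  apply: cech_exact_big => //; first by rewrite Gr ltnW.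
  by lia.
- exact: pihomogP.
Qed.

End Cech.

(** * Straightening to squarefree monomials *)

Section Squarefree.
Variables (k : fieldType) (N : nat).
Local Notation S := {mpoly k[N]}.
Implicit Types (m : 'X_{1..N}) (G H : {set 'I_N}).

Definition xset H : S := \prod_(v in H) 'X_v.

Lemma xsetE H : xset H = 'X_[mesym1 H].
Proof.
rewrite mpolyXE_id /xset big_mkcond; apply: eq_bigr => v _.
by rewrite mnmE; case: (v \in H); rewrite ?expr1 ?expr0.
Qed.

Lemma xset0 : xset set0 = 1.
Proof. by rewrite /xset big_set0. Qed.

Lemma xsetU1 v H : v \notin H -> xset (v |: H) = 'X_v * xset H.
Proof. exact: big_setU1. Qed.

Lemma xsetU G H : [disjoint G & H] -> xset (G :|: H) = xset G * xset H.
Proof.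
by move=> dGH; rewrite /xset -bigU //; apply: eq_bigl => v; rewrite !inE.
Qed.

Lemma msupport_mesym1 H : msupport (mesym1 H) = H.
Proof. by apply/setP => v; rewrite inE mnmE; case: (v \in H). Qed.

Lemma xset_homog H : xset H \is #|H|.-homog.
Proof. by rewrite xsetE dhomogX; apply/eqP/mdeg_mesym1. Qed.

Lemma meval_xset p H : (xset H).@[p] = \prod_(v in H) p v.
Proof. by rewrite /xset rmorph_prod; apply: eq_bigr => v _; rewrite /= mevalXU. Qed.

Lemma card_msupport m : (#|msupport m| <= mdeg m)%N.
Proof.
rewrite mdegE -sum1_card big_mkcond; apply: leq_sum => v _.
by rewrite inE; case: (m v).
Qed.

Lemma mesym1_msupport m : (forall v, (m v <= 1)%N) -> m = mesym1 (msupport m).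
Proof.
by move=> m1; apply/mnmP => v; rewrite mnmE inE; case: (m v) (m1 v) => [|[|]].
Qed.

(** The sign comparing the orientations of [H] and of [G :|: H]. *)
Definition tau G H : k := \prod_(u in H) sgn k u G.

Lemma tau_neq0 G H : tau G H != 0.
Proof. by apply/prodf_neq0 => u _; apply: sgn_neq0. Qed.

Lemma sgn_tau G H u : [disjoint G & H] -> u \in H ->
  tau G H * sgn k u H = tau G (H :\ u) * sgn k u (G :|: H).
Proof.
move=> dGH uH; rewrite sgnU // mulrA; congr (_ * _).
by rewrite /tau (big_setD1 u) //= mulrC.
Qed.

Lemma sum_setD1 (V : nmodType) (P : pred {set 'I_N}) (T : {set 'I_N} -> 'I_N -> V) :
  \sum_(H : {set 'I_N} | P H) \sum_(u in H) T H u =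
  \sum_(H : {set 'I_N}) \sum_(u : 'I_N | (u \notin H) && P (u |: H)) T (u |: H) u.
Proof.
rewrite (exchange_big_dep xpredT) //= [RHS](exchange_big_dep xpredT) //=.
apply: eq_bigr => u _.
rewrite (reindex_onto (fun H : {set 'I_N} => u |: H) (fun H => H :\ u)) /=.
  apply: eq_bigl => H; rewrite setU11 andbT andbC; congr (_ && _).
  apply/eqP/idP => [<-|uH]; first by rewrite setD11.
  by rewrite setU1K.
by move=> H /andP [_ uH]; rewrite setD1K.
Qed.

End Squarefree.

Section Straightening.
Variables (k : fieldType) (N d : nat) (Gamma : {set {set 'I_N}}) (th : nat -> 'I_N -> k).
Local Notation S := {mpoly k[N]}.
Local Notation lk := (link Gamma).
Local Notation istar := (istar Gamma th).
Implicit Types (m : 'X_{1..N}) (F G H K : {set 'I_N}) (f g : S).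

Hypothesis Gamma_down : downward Gamma.
Hypothesis Gamma_card : forall F, F \in Gamma -> (#|F| <= d)%N.
Hypothesis th_generic : generic_rows d th.

Definition straightens G r i f := exists c : {set 'I_N} -> k,
  istar G r (f - \sum_(H in lk G | #|H| == i) c H *: xset k H).

Lemma straightens_istar G r i f : istar G r f -> straightens G r i f.
Proof.
move=> hf; exists (fun _ => 0); rewrite big1 ?subr0 // => H _; exact: scale0r.
Qed.

Lemma straightensD G r i f g :
  straightens G r i f -> straightens G r i g -> straightens G r i (f + g).
Proof.
case=> c hc [c' hc']; exists (fun H => c H + c' H).
under eq_bigr => H _ do rewrite scalerDl.
by rewrite big_split /= opprD addrACA; apply: istarD.
Qed.

Lemma straightensZ G r i x f : straightens G r i f -> straightens G r i (x *: f).
Proof.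
case=> c hc; exists (fun H => x * c H).
under eq_bigr => H _ do rewrite -scalerA.
by rewrite -scaler_sumr -scalerBr; apply: istarZ.
Qed.

(** A variable whose removal does not change [msupport m :|: G] is traded, by a
    linear form of the ideal dual to it, for variables that enlarge this set. *)
Lemma straighten_monomial G r m : (r <= d)%N ->
  (mdeg m + #|G| <= r)%N \/ r = d -> straightens G r (mdeg m) 'X_[m].
Proof.
move=> rd; move: {2}(N - #|msupport m :|: G|)%N (erefl (N - #|msupport m :|: G|)%N) => c.
elim/ltn_ind: c m => c IH m cm mr.
have [KG|] := boolP (msupport m :|: G \in Gamma); last first.
  by move=> mG; apply/straightens_istar/nonstar_istar/nonstarX.
have [/existsP [u /andP [um uG]]|] :=
    boolP [exists u, (m u != 0%N) && ((u \in G) || (1 < m u)%N)]; last first.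
  move=> /existsPn mu; have m1 v : (m v <= 1)%N.
    by have := mu v; rewrite negb_and negb_or; lia.
  exists (fun H => (H == msupport m)%:R).
  have mE := mesym1_msupport m1.
  rewrite (bigD1 (msupport m)) /=; last first.
    rewrite mem_link // setUC KG andbT; apply/andP; split; last first.
      by apply/eqP; rewrite [in RHS]mE mdeg_mesym1.
    rewrite -setI_eq0; apply/eqP/setP => v; rewrite !inE; have := mu v.
    by case: (m v != 0%N) => //=; rewrite negb_or => /andP [/negbTE ->].
  rewrite eqxx scale1r xsetE -mE big1 ?addr0 ?subrr; first exact: istar0.
  by move=> H /andP [_ /negbTE ->]; rewrite scale0r.
pose m' := (m - U_(u))%MM.
have m'E : m = (U_(u) + m')%MM by rewrite addmC submK // lep1mP.
set K := msupport m :|: G in cm KG.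
have m'K : msupport m' :|: G = K.
  rewrite /K m'E msupportD msupportU.
  have : u \in msupport m' :|: G.
    by rewrite !inE mnmBE mnm1E eqxx; case/orP: uG => [->|]; rewrite ?orbT //; lia.
  by rewrite -setUA => uK; apply/esym/setUidPr; rewrite sub1set.
have Kr : (#|K| <= r)%N.
  case: mr => [mr|->]; last exact: Gamma_card.
  apply: leq_trans mr; rewrite /K cardsU; have := card_msupport m; lia.
have Kd : minor th #|K| K != 0 by apply: th_generic; apply: leq_trans rd.
have uK : u \in K by rewrite !inE um.
have [e es eK] := dual_form Kd uK.
have -> : 'X_[m] = 'X_[m'] * lin e - \sum_(w | w \notin K) e w *: 'X_[(U_(w) + m')%MM].
  rewrite /lin mulr_sumr (bigID (mem K)) /= (bigD1 u) //= eK // eqxx scale1r.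
  rewrite big1 ?addr0 => [|v /andP [vK nvu]]; last first.
    by rewrite eK // (negbTE nvu) scale0r mulr0.
  rewrite -mpolyXD -addmC -m'E -[LHS]addr0 -[RHS]addrA; congr (_ + _).
  rewrite -sumrB big1 // => w _.
  by rewrite -scalerAr -mpolyXD addmC subrr.
apply: straightensD.
  apply/straightens_istar/istarM => //.
  by apply: istar_row_span => //; apply: row_spanS es.
rewrite -sumrN.
apply: big_ind => [|f g|w wK]; [exact/straightens_istar/istar0 | exact: straightensD |].
rewrite -scaleNr; apply: straightensZ.
have -> : mdeg m = mdeg (U_(w) + m') by rewrite m'E !mdegD !mdeg1.
have wKE : msupport (U_(w) + m') :|: G = w |: K.
  by rewrite msupportD msupportU -setUA m'K.
apply: (IH (N - #|msupport (U_(w) + m') :|: G|)%N) => //.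
  rewrite wKE -cm cardsU1 wK; have := max_card (mem (w |: K)).
  by rewrite cardsU1 wK card_ord; lia.
by move: mr; rewrite m'E !mdegD !mdeg1.
Qed.

Lemma straighten_homog G r i f : (r <= d)%N -> (i + #|G| <= r)%N \/ r = d ->
  f \is i.-homog -> straightens G r i f.
Proof.
move=> rd ir; apply: mpoly_homog_ind => [|g h|c m mi].
- exact/straightens_istar/istar0.
- exact: straightensD.
- by apply: straightensZ; rewrite -mi; apply: straighten_monomial; rewrite ?mi.
Qed.

(** No face of the link of [G] is left for a straightened monomial. *)
Lemma istar_above G i f : G \in Gamma -> (d < i + #|G|)%N -> f \is i.-homog ->
  istar G d f.
Proof.
move=> GG di /(straighten_homog (G := G) (leqnn d) (or_intror erefl)) [c].
rewrite big1 ?subr0 // => H /andP [HG /eqP Hi].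
by have := link_card Gamma_down Gamma_card GG HG; have := Gamma_card GG; lia.
Qed.

(** Cramer's rule for the ridge [G :|: H] relates the facets around it. *)
Lemma ridge_relation G H :
  istar G d (\sum_(u | u \notin G :|: H)
    (sgn k u (u |: (G :|: H)) * minor th d (u |: (G :|: H))) *: xset k (u |: H)).
Proof.
have -> : \sum_(u | u \notin G :|: H)
    (sgn k u (u |: (G :|: H)) * minor th d (u |: (G :|: H))) *: xset k (u |: H) =
    xset k H * lin (cramer th d (G :|: H)).
  rewrite /lin mulr_sumr big_mkcond; apply: eq_bigr => u _; rewrite /cramer.
  case: ifPn => uGH; last by rewrite negbK in uGH; rewrite uGH scale0r mulr0.
  have uH : u \notin H by apply: contra uGH => uH; rewrite inE uH orbT.
  by rewrite (negbTE uGH) -scalerAr xsetU1 // [_ * 'X_u]mulrC.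
by apply: istarM => //; apply: istar_row_span => //; apply: cramer_row_span.
Qed.

(** With the weights [tau * minor] the relations around the ridges become the
    coboundaries on the link. *)
Lemma coboundary_relation G (g : {set 'I_N} -> k) : G \in Gamma ->
  istar G d (\sum_(H in lk G | #|H| == (d - #|G|)%N)
    (tau k G H * minor th d (G :|: H) * cob g H) *: xset k H).
Proof.
move=> GG; set e := (d - #|G|)%N.
under eq_bigr => H _ do rewrite /cob mulr_sumr scaler_suml.
rewrite (sum_setD1 (fun H => (H \in lk G) && (#|H| == e)) (fun H u =>
  (tau k G H * minor th d (G :|: H) * (sgn k u H * g (H :\ u))) *: xset k H)).
apply: istar_sum => // H _.
have [HG|HG] := boolP (H \in lk G); last first.
  rewrite big_pred0; first exact: istar0.
  move=> u; apply/negP => /andP [uH /andP [uHG _]]; case/negP: HG.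
  by rewrite -(setU1K uH); apply: link_D1.
have [/eqP He|He] := boolP (#|H|.+1 == e); last first.
  rewrite big_pred0; first exact: istar0.
  by move=> u; apply/negP => /andP [uH /andP [_]]; rewrite cardsU1 uH add1n (negbTE He).
have dGH : [disjoint H & G] by move: HG; rewrite mem_link // => /andP [].
apply: (istar_trans (g := (g H * tau k G H) *: (\sum_(u | u \notin G :|: H)
    (sgn k u (u |: (G :|: H)) * minor th d (u |: (G :|: H))) *: xset k (u |: H)))) => //;
  last by apply: istarZ => //; apply: ridge_relation.
rewrite scaler_sumr [X in _ - X](bigID (fun u => G :|: (u |: H) \in Gamma)) /=.
rewrite [X in _ - (X + _)](_ : _ =
    \sum_(u | (u \notin H) && ((u |: H \in lk G) && (#|u |: H| == e)))
      (tau k G (u |: H) * minor th d (G :|: (u |: H)) *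
       (sgn k u (u |: H) * g ((u |: H) :\ u))) *: xset k (u |: H)).
  rewrite opprD addrA subrr sub0r; apply: istarN => //.
  apply: istar_sum => // u /andP [uGH uN].
  apply: istarZ => //; apply: istarZ => //; apply: nonstar_istar.
  rewrite xsetE; apply: nonstarX.
  by rewrite msupport_mesym1 setUC.
apply: eq_big => u.
  rewrite inE negb_or mem_link // cardsU1.
  rewrite -!setI_eq0 setIUl setU_eq0 !setI_eq0 disjoints1 dGH andbT.
  by case: (u \in H); rewrite ?andbF //= add1n He eqxx !andbT.
rewrite inE negb_or => /andP [/andP [uG uH] _].
rewrite scalerA setU1K // setUCA; congr (_ *: _).
have := @sgn_tau k N G (u |: H) u; rewrite setU1K // setUCA => E.
have {}E : tau k G (u |: H) * sgn k u (u |: H) = tau k G H * sgn k u (u |: (G :|: H)).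
  apply: E; last exact: setU11.
  by rewrite disjoint_sym -setI_eq0 setIUl setU_eq0 !setI_eq0 disjoints1 uG.
transitivity (tau k G (u |: H) * sgn k u (u |: H) * minor th d (u |: (G :|: H)) * g H).
  by rewrite E; ring.
by ring.
Qed.

Lemma istar_xset G r f : istar G r f -> istar set0 r (xset k G * f).
Proof.
move: {2}#|G| (erefl #|G|) => c; elim: c G f => [|c IH] G f Gc fG.
  move/eqP: Gc; rewrite cards_eq0 => /eqP G0.
  by move: fG; rewrite G0 xset0 mul1r.
have /card_gt0P [v vG] : (0 < #|G|)%N by rewrite Gc.
rewrite -(setD1K vG) xsetU1 ?setD11 // [_ * xset _ _]mulrC -mulrA.
apply: IH; first by move: Gc; rewrite (cardsD1 v G) vG => -[].
by apply: istar_var; rewrite setD1K.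
Qed.

End Straightening.

(** * The degree map of a cycle *)

Section Sets.
Variables (T : finType).
Implicit Types (G F : {set T}).

Lemma exists_setU1 G F : G \subset F -> #|F| = #|G|.+1 -> exists2 u, u \notin G & F = u |: G.
Proof.
move=> GF Fd; have [u uFG] : exists u, F :\: G = [set u].
  by apply/cards1P; rewrite cardsD (setIidPr GF) Fd subSnn.
exists u; first by have := set11 u; rewrite -uFG inE => /andP [].
rewrite -uFG; apply/setP => x; rewrite !inE.
by case: (boolP (x \in G)) => [/(subsetP GF) ->|_]; rewrite ?orbF ?orbT.
Qed.

End Sets.

Section DegreeMap.
Variables (k : fieldType) (N d' : nat) (Gamma : {set {set 'I_N}}).
Variables (th : nat -> 'I_N -> k) (z : {set 'I_N} -> k).
Local Notation d := d'.+1.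
Local Notation S := {mpoly k[N]}.
Local Notation istar := (istar Gamma th).
Local Notation nonstar := (@nonstar k N Gamma).
Implicit Types (m : 'X_{1..N}) (F G H K : {set 'I_N}) (f g : S).

Hypothesis Gamma_down : downward Gamma.
Hypothesis Gamma_card : forall F, F \in Gamma -> (#|F| <= d)%N.
Hypothesis th_generic : generic_rows d th.
Hypothesis z_cycle : forall g : {set 'I_N} -> k, \sum_F z F * cob g F = 0.
Hypothesis z_supp : forall F, z F != 0 -> F \in Gamma /\ #|F| = d.

(** The point with support [F] at which the first [d'] forms vanish and the
    last one takes the value [1], by Cramer's rule. *)
Definition facet_point F u : k :=
  if u \in F then sgn k u F * minor th d' (F :\ u) / minor th d F else 0.

Lemma facet_minor_neq0 F : #|F| = d -> minor th d F != 0.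
Proof. by move=> Fd; rewrite -{1}Fd; apply: th_generic; rewrite Fd. Qed.

Lemma facet_point_neq0 F u : #|F| = d -> u \in F -> facet_point F u != 0.
Proof.
move=> Fd uF; rewrite /facet_point uF mulf_neq0 ?invr_eq0 ?facet_minor_neq0 //.
rewrite mulf_neq0 ?sgn_neq0 //.
have Fu : #|F :\ u| = d' by move: Fd; rewrite (cardsD1 u F) uF => -[].
by rewrite -{1}Fu; apply: th_generic; rewrite Fu.
Qed.

Lemma lin_facet_point F i :
  (lin (th i)).@[facet_point F] = cobd (th i) (minor th d') F / minor th d F.
Proof.
rewrite meval_lin /cobd mulr_suml [RHS]big_mkcond; apply: eq_bigr => u _.
rewrite /facet_point; case: ifP => _; last by rewrite mulr0.
by rewrite [_ *: _]/(_ * _) !mulrA (mulrC (th i u)).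
Qed.

Definition weight F : k := z F / (minor th d F * \prod_(u in F) facet_point F u).

(** A residue sum over the points where the initial forms vanish; in degree [d]
    it will be the degree map. *)
Definition facet_sum f : k := \sum_F weight F * f.@[facet_point F].

Lemma facet_sumD f g : facet_sum (f + g) = facet_sum f + facet_sum g.
Proof.
by rewrite /facet_sum -big_split; apply: eq_bigr => F _; rewrite mevalD mulrDr.
Qed.

Lemma facet_sumZ c f : facet_sum (c *: f) = c * facet_sum f.
Proof.
by rewrite /facet_sum mulr_sumr; apply: eq_bigr => F _; rewrite mevalZ mulrCA.
Qed.

Lemma facet_sum_sum (I : Type) (s : seq I) (P : pred I) (F : I -> S) :
  facet_sum (\sum_(i <- s | P i) F i) = \sum_(i <- s | P i) facet_sum (F i).
Proof.
apply: (big_morph facet_sum facet_sumD).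
by rewrite -(scale0r (0 : S)) facet_sumZ mul0r.
Qed.

Lemma weight_eq0 F : z F = 0 -> weight F = 0.
Proof. by rewrite /weight => ->; rewrite mul0r. Qed.

Lemma weight_neq0 F : weight F != 0 -> F \in Gamma /\ #|F| = d.
Proof. by move=> wF; apply: z_supp; apply: contraNneq wF => /weight_eq0 ->. Qed.

Lemma facet_sum_nonstar f : nonstar set0 f -> facet_sum f = 0.
Proof.
move=> hf; apply: big1 => F _.
have [->|/weight_neq0 [FG _]] := eqVneq (weight F) 0; first exact: mul0r.
rewrite mevalE big_seq big1 ?mulr0 // => m; rewrite mcoeff_msupp => fm.
have [u um uF] : exists2 u, u \in msupport m & u \notin F.
  apply/subsetPn; apply: contra fm => mF; apply/eqP/hf; rewrite setU0.
  exact: Gamma_down FG mF.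
rewrite (bigD1 u) //= /facet_point (negbTE uF) expr0n.
by move: um; rewrite inE => /negbTE ->; rewrite mul0r mulr0.
Qed.

Lemma facet_sum_row i f : (i < d')%N -> facet_sum (f * lin (th i)) = 0.
Proof.
move=> id; apply: big1 => F _; rewrite mevalM lin_facet_point cobd_row_minor //.
by rewrite mul0r !mulr0.
Qed.

Lemma facet_sum_last f : facet_sum (f * lin (th d')) = facet_sum f.
Proof.
apply: eq_bigr => F _.
have [->|/weight_neq0 [FG Fd]] := eqVneq (weight F) 0; first by rewrite !mul0r.
rewrite mevalM lin_facet_point -[cobd _ _ _]/(minor th d F).
by rewrite divff ?facet_minor_neq0 // mulr1.
Qed.

Lemma facet_sum_istar f : istar set0 d' f -> facet_sum f = 0.
Proof.
case=> h /facet_sum_nonstar.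
rewrite -scaleN1r facet_sumD facet_sumZ facet_sum_sum big1 ?mulr0 ?addr0 //.
by move=> i _; apply: facet_sum_row.
Qed.

Lemma cob_indicator (H F : {set 'I_N}) : cob (fun G => (G == H)%:R : k) F =
  \sum_(u in F | F :\ u == H) sgn k u F.
Proof.
rewrite /cob [RHS]big_mkcondr; apply: eq_bigr => u _.
by case: eqP => _; rewrite ?mulr1 ?mulr0.
Qed.

(** On a ridge the weighted sum is, up to a unit, the coefficient of the
    boundary of the cycle [z]. *)
Lemma facet_sum_ridge H : #|H| = d' -> facet_sum (xset k H) = 0.
Proof.
move=> Hd.
have Hm : minor th d' H != 0 by rewrite -{1}Hd; apply: th_generic; rewrite Hd.
transitivity ((minor th d' H)^-1 * \sum_F z F * cob (fun G => (G == H)%:R : k) F);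
  last by rewrite z_cycle mulr0.
rewrite mulr_sumr; apply: eq_bigr => F _; rewrite cob_indicator meval_xset.
have [zF|/z_supp [FG Fd]] := eqVneq (z F) 0.
  by rewrite weight_eq0 // zF !mul0r mulr0.
have [HF|/subsetPn [v vH vF]] := boolP (H \subset F); last first.
  rewrite (bigD1 v) //= {1}/facet_point (negbTE vF) mul0r mulr0 big_pred0 ?mulr0 //.
  by move=> u; apply/negP => /andP [_ /eqP E]; rewrite -E inE (negbTE vF) andbF in vH.
have [u uH FE] := exists_setU1 HF (etrans Fd (congr1 succn (esym Hd))).
have uF : u \in F by rewrite FE setU11.
rewrite [X in _ = _ * (_ * X)](bigD1 u) /=; last by rewrite uF FE setU1K // eqxx.
rewrite [X in _ + X]big1 ?addr0 => [|v /andP [/andP [vF /eqP E] nvu]]; last first.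
  by move: uH; rewrite -E !inE eq_sym nvu uF.
rewrite /weight [in X in _ / X]FE big_setU1 //= -FE.
have p0 : \prod_(v in H) facet_point F v != 0.
  by apply/prodf_neq0 => v vH; apply: facet_point_neq0 => //; apply: (subsetP HF).
have -> : facet_point F u = sgn k u F * minor th d' H / minor th d F.
  by rewrite /facet_point uF [F :\ u](_ : _ = H) // FE setU1K.
have Fm := facet_minor_neq0 Fd.
move: p0; set p := \prod_(_ in _) _ => p0.
have s0 : sgn k u F != 0 := sgn_neq0 _ _ _.
have sV : (sgn k u F)^-1 = sgn k u F by apply: (mulfI s0); rewrite sgn_sq divff.
rewrite -[cobd _ _ _]/(minor th d F).
transitivity (z F * (sgn k u F)^-1 * (minor th d' H)^-1); last by rewrite sV; ring.
by field; rewrite p0 Hm s0 Fm.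
Qed.

(** Straightening with the first [d'] forms, on which the sum vanishes, reduces
    to the monomials of ridges. *)
Lemma facet_sum_homog f : f \is d'.-homog -> facet_sum f = 0.
Proof.
move=> fd.
have [|c hc] := straighten_homog Gamma_down Gamma_card th_generic (G := set0) (leqnSn d') _ fd.
  by left; rewrite cards0 addn0.
rewrite -(subrK (\sum_(H in link Gamma set0 | #|H| == d') c H *: xset k H) f).
rewrite facet_sumD facet_sum_istar // add0r facet_sum_sum big1 // => H /andP [_ /eqP Hd].
by rewrite facet_sumZ facet_sum_ridge // mulr0.
Qed.

Definition degree f : k := facet_sum (pihomog mdeg d f).

Lemma degreeD f g : degree (f + g) = degree f + degree g.
Proof. by rewrite /degree pihomogD facet_sumD. Qed.

Lemma degreeZ c f : degree (c *: f) = c * degree f.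
Proof. by rewrite /degree linearZ facet_sumZ. Qed.

Lemma degree_pihomog f : degree (pihomog mdeg d f) = degree f.
Proof. by rewrite /degree pihomog_id. Qed.

(** At the facet points the last form is [1], so multiplying by it leaves the
    sum in degree [d'], which is zero. *)
Lemma degree_istar f : istar set0 d f -> degree f = 0.
Proof.
case=> h /(nonstar_pihomog d)/facet_sum_nonstar.
rewrite /degree pihomogB -scaleN1r facet_sumD facet_sumZ.
rewrite [pihomog _ _ (\sum_(_ < _) _)]raddf_sum.
rewrite [facet_sum (\sum_(_ < _) _)]facet_sum_sum /=.
rewrite big1 ?mulr0 ?addr0 // => i _. rewrite pihomog_mul_lin.
have := ltn_ord i; rewrite ltnS leq_eqVlt => /orP [/eqP ->|]; last exact: facet_sum_row.
by rewrite facet_sum_last facet_sum_homog // pihomogP.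
Qed.

Lemma degree_xset F : #|F| = d -> degree (xset k F) = z F / minor th d F.
Proof.
move=> Fd; rewrite /degree pihomog_dE; last by rewrite -Fd xset_homog.
rewrite /facet_sum (bigD1 F) //= big1 ?addr0 => [|G nGF].
  rewrite meval_xset /weight invfM !mulrA -mulrA mulVf ?mulr1 //.
  by apply/prodf_neq0 => u uF; apply: facet_point_neq0.
have [->|/weight_neq0 [GG Gd]] := eqVneq (weight G) 0; first exact: mul0r.
have [u uF uG] : exists2 u, u \in F & u \notin G.
  apply/subsetPn; apply: contra nGF => FG; by rewrite eq_sym eqEcard FG Fd Gd leqnn.
by rewrite meval_xset (bigD1 u) //= /facet_point (negbTE uG) mul0r mulr0.
Qed.

End DegreeMap.

(** * Poincare duality of stars *)

Section Duality.
Variables (k : fieldType) (N d' : nat) (Gamma : {set {set 'I_N}}).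
Variables (th : nat -> 'I_N -> k) (Q : pred {set 'I_N}) (z : {set 'I_N} -> k).
Local Notation d := d'.+1.
Local Notation S := {mpoly k[N]}.
Local Notation lk := (link Gamma).
Local Notation istar := (istar Gamma th).
Local Notation deg := (degree d' th z).
Implicit Types (m : 'X_{1..N}) (F G H K : {set 'I_N}) (f g : S).

Hypothesis Gamma_down : downward Gamma.
Hypothesis Gamma_card : forall F, F \in Gamma -> (#|F| <= d)%N.
Hypothesis Gamma_pure : forall G, G \in Gamma ->
  exists F, [/\ F \in Gamma, G \subset F & #|F| = d].
Hypothesis th_generic : generic_rows d th.
Hypothesis Q_up : forall G H, Q G -> G \subset H -> Q H.
Hypothesis Q_coh : forall G, G \in Gamma -> Q G ->
  forall j, j != (d - #|G|)%N -> coh_zero k (lk G) j.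
Hypothesis Q_top : forall G, G \in Gamma -> Q G -> coh_le1 k (lk G) (d - #|G|).
Hypothesis z_cycle : forall g : {set 'I_N} -> k, \sum_F z F * cob g F = 0.
Hypothesis z_supp : forall F, z F != 0 -> F \in Gamma /\ #|F| = d.

(** In the star of a face in [Q] a cycle is zero on every facet or on none:
    across a ridge since the link has at most two points, and otherwise since
    the link is connected. *)
Lemma cycle_star_neq0 G F F' : Q G -> G \subset F -> G \subset F' ->
  z F' != 0 -> F \in Gamma -> #|F| = d -> z F != 0.
Proof.
move: {2}(d - #|G|)%N (erefl (d - #|G|)%N) => e.
elim: e G F F' => [|e IH] G F F' Ge QG GF GF' zF' FG Fd.
  have [F'G F'd] := z_supp zF'.
  have Gd : #|G| = d.
    by have := subset_leq_card GF; rewrite Fd; lia.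
  have GE : G = F by apply/eqP; rewrite eqEcard GF Gd Fd leqnn.
  have GE' : G = F' by apply/eqP; rewrite eqEcard GF' Gd F'd leqnn.
  by rewrite -GE GE'.
have GG : G \in Gamma := Gamma_down FG GF.
have [F'G F'd] := z_supp zF'.
have lkP F1 v : F1 \in Gamma -> v \in F1 -> G \subset F1 -> v \notin G -> [set v] \in lk G.
  move=> F1G vF1 GF1 vG; rewrite mem_link // disjoints1 vG.
  by apply: Gamma_down F1G _; rewrite subUset GF1 sub1set.
have subv F1 v : v \in F1 -> G \subset F1 -> v |: G \subset F1.
  by move=> vF GF1; rewrite subUset sub1set vF.
case: e => [|e] in IH Ge.
  have Gd : d = #|G|.+1 by rewrite -(subnKC (Gamma_card GG)) Ge addn1.
  have [u uG FE] := exists_setU1 GF (etrans Fd Gd).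
  have [u' u'G FE'] := exists_setU1 GF' (etrans F'd Gd).
  apply/negP => /eqP zF.
  have nuu' : u != u' by apply: contraNneq zF' => E; rewrite FE' -E -FE zF.
  have coc (v : 'I_N) : cocycle (lk G) 1 (fun H => (H == [set v])%:R : k).
    by move=> K /(link_card Gamma_down Gamma_card GG); rewrite Ge => + K2; rewrite K2.
  have := Q_top GG QG; rewrite Ge => /(_ _ _ (coc u') (coc u)) [a [b [nab [g gE]]]].
  have gE1 v : v \notin G -> v |: G \in Gamma ->
      a * (v == u')%:R + b * (v == u)%:R = g set0.
    move=> vG vGG; have := gE [set v]; rewrite cards1 mem_link // disjoints1 vG setUC vGG.
    by rewrite !(inj_eq set1_inj) => -> //; rewrite /cob big_set1 setDv sgn_set1 ltnn mul1r.
  have E1 := gE1 u' u'G; rewrite eqxx (eq_sym u') (negbTE nuu') mulr1 mulr0 addr0 in E1.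
  have E2 := gE1 u uG; rewrite eqxx (negbTE nuu') mulr1 mulr0 add0r in E2.
  rewrite -FE' in E1; rewrite -FE in E2; have {}E1 := E1 F'G; have {}E2 := E2 FG.
  have g0 : g set0 != 0 by move: nab; rewrite E1 E2 orbb.
  have := z_cycle (fun H => (H == G)%:R); rewrite (bigD1 F') //= big1 => [|F1 nF1].
    rewrite addr0 cob_indicator FE' (bigD1 u') /=; last by rewrite setU11 setU1K // eqxx.
    rewrite big1 ?addr0 => [|v /andP [/andP [vF /eqP vE] nv]]; last first.
      by case/negP: u'G; rewrite -vE !inE eqxx eq_sym nv.
    move/eqP; rewrite mulf_eq0 (negbTE (sgn_neq0 _ _ _)) orbF -FE'.
    by rewrite (negbTE zF').
  have [->|zF1] := eqVneq (z F1) 0; first exact: mul0r.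
  have [F1G F1d] := z_supp zF1.
  rewrite cob_indicator big_pred0 ?mulr0 // => v; apply/negP => /andP [vF1 /eqP vE].
  have vG : v \notin G by rewrite -vE setD11.
  have F1E : F1 = v |: G by rewrite -vE setD1K.
  have := gE1 v vG; rewrite -F1E => /(_ F1G).
  have -> : (v == u') = false by apply: contraNF nF1 => /eqP vu; rewrite F1E vu -FE'.
  have [vu|_] := eqVneq v u; last by rewrite !mulr0 addr0 => g0'; rewrite -g0' eqxx in g0.
  by rewrite F1E vu -FE zF eqxx in zF1.
pose pz v := [exists F1, [&& F1 \in Gamma, v |: G \subset F1 & z F1 != 0]].
have pzP F1 v : v |: G \subset F1 -> z F1 != 0 -> pz v.
  by move=> vF1 zF1; apply/existsP; exists F1; rewrite vF1 zF1 (z_supp zF1).1.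
have pz_star v F1 : v \notin G -> pz v -> F1 \in Gamma -> #|F1| = d ->
    v |: G \subset F1 -> z F1 != 0.
  move=> vG /existsP [F2 /and3P [F2G vF2 zF2]] F1G F1d vF1.
  have cvG : (d - #|v |: G|)%N = e.+1 by rewrite cardsU1 vG add1n subnS Ge.
  exact: (IH _ F1 F2 cvG (Q_up QG (subsetUr _ _)) vF1 vF2 zF2 F1G F1d).
have pz_edge x y : x \notin G -> [set x; y] :|: G \in Gamma -> pz x -> pz y.
  move=> xG xyG px; have [F2 [F2G sF2 F2d]] := Gamma_pure xyG.
  have xF2 : x |: G \subset F2.
    by apply: subset_trans sF2; rewrite setSU // sub1set !inE eqxx.
  apply: (pzP F2); last exact: (pz_star x).
  by apply: subset_trans sF2; rewrite setSU // sub1set !inE eqxx orbT.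
pose f H : k := [exists v in H, pz v]%:R.
have f1 v : f [set v] = (pz v)%:R.
  rewrite /f; congr (nat_of_bool _)%:R; apply/existsP/idP => [[w]|pv].
    by rewrite inE => /andP [/eqP ->].
  by exists v; rewrite set11.
have ne : 1%N != (d - #|G|)%N by rewrite Ge.
have [|g gE] := Q_coh GG QG ne (f := f).
  move=> K KG /eqP/cards2P [x [y [nxy KE]]].
  move: KG; rewrite KE mem_link // -setI_eq0 setIUl setU_eq0 !setI_eq0 !disjoints1.
  case/andP=> /andP [xG yG]; rewrite setUC => xyG.
  have pxy : pz x = pz y.
    apply/idP/idP; first exact: pz_edge.
    by apply: pz_edge => //; rewrite (setUC [set y]).
  rewrite /cob big_setU1 ?inE //= big_set1.
  have -> : [set x; y] :\ x = [set y].
    by apply/setP => w; rewrite !inE; case: (eqVneq w x) => [->|]; rewrite ?(negbTE nxy).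
  have -> : [set x; y] :\ y = [set x].
    apply/setP => w; rewrite !inE.
    by case: (eqVneq w y) => [->|]; rewrite ?orbF // eq_sym (negbTE nxy).
  rewrite !f1 pxy -mulrDl !(@sgnU1 k N _ x) ?inE // !sgn_set1 !ltnn.
  by move: nxy; rewrite -val_eqE /=; case: ltngtP => // _ _;
    rewrite ?(mulr1, mul1r) ?addNr ?subrr mul0r.
have fc v F1 : v \notin G -> v \in F1 -> G \subset F1 -> F1 \in Gamma ->
    (pz v)%:R = g set0 :> k.
  move=> vG vF1 GF1 F1G; rewrite -f1 gE ?cards1 //; last exact: (lkP F1).
  by rewrite /cob big_set1 setDv sgn_set1 ltnn mul1r.
have new F1 : #|F1| = d -> exists2 v, v \in F1 & v \notin G.
  by move=> F1d; apply/subsetPn; apply/negP => /subset_leq_card; lia.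
have [v' v'F v'G] := new _ F'd; have [v vF vG] := new _ Fd.
have pv' : pz v' by apply: (pzP F') => //; apply: subv.
apply: (pz_star v) => //; last exact: subv.
have := fc v F vG vF GF FG; rewrite -(fc v' F') // pv' => /eqP.
by case: (pz v) => //; rewrite eq_sym oner_eq0.
Qed.

(** A straightened form is a top cochain of the link; being orthogonal to the
    nonzero cycle [z] it is a coboundary, and coboundaries are relations. *)
Lemma star_dual_top G f : G \in Gamma -> coh_le1 k (lk G) (d - #|G|) ->
  (exists F, [/\ F \in Gamma, G \subset F, #|F| = d & z F != 0]) ->
  f \is (d - #|G|).-homog -> deg (xset k G * f) = 0 -> istar G d f.
Proof.
move=> GG top [F0 [F0G GF0 F0d zF0]] fe degf; set e := (d - #|G|)%N in top fe *.
have Gd := Gamma_card GG.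
have [c fc] := straighten_homog Gamma_down Gamma_card th_generic (leqnn d)
  (or_intror erefl : (e + #|G| <= d)%N \/ d = d) fe.
pose H0 := F0 :\: G.
have dH0 : [disjoint H0 & G] by rewrite -setI_eq0 /H0 setDE -setIA [_ :&: G]setIC setICr setI0.
have GH0 : G :|: H0 = F0.
  apply/setP => x; rewrite !inE.
  by case: (boolP (x \in G)) => [/(subsetP GF0) ->|_].
have H0lk : H0 \in lk G by rewrite mem_link // dH0 GH0.
have H0e : #|H0| = e by rewrite cardsD (setIidPr GF0) F0d.
pose w H := tau k G H * minor th d (G :|: H).
have w0 H : H \in lk G -> #|H| = e -> w H != 0.
  move=> HG He; rewrite mulf_neq0 ?tau_neq0 //.
  have GHd : #|G :|: H| = d by rewrite (link_card_faceU Gamma_down HG) He; lia.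
  by rewrite -{1}GHd; apply: th_generic; rewrite GHd.
have coc (f1 : {set 'I_N} -> k) : cocycle (lk G) e f1.
  by move=> K /(link_card Gamma_down Gamma_card GG) => + Ke; rewrite Ke ltnn.
have [a [b [nab [g gE]]]] := top _ _ (coc (fun H => c H / w H))
  (coc (fun H => (H == H0)%:R / w H)).
have rel : istar G d (a *: (\sum_(H in lk G | #|H| == e) c H *: xset k H) + b *: xset k H0).
  have := coboundary_relation d th Gamma_down g GG.
  congr (istar G d _).
  transitivity (\sum_(H in lk G | #|H| == e) (a * c H + b * (H == H0)%:R) *: xset k H).
    apply: eq_bigr => H /andP [HG /eqP He]; rewrite -gE // -/(w H).
    by congr (_ *: _); have := w0 H HG He => w0H; field.
  under eq_bigr => H _ do rewrite scalerDl -!scalerA.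
  rewrite big_split /= -!scaler_sumr; congr (_ + _ *: _).
  rewrite (bigD1 H0) /=; last by rewrite H0lk H0e eqxx.
  rewrite eqxx scale1r big1 ?addr0 // => H /andP [_ /negbTE ->].
  by rewrite scale0r.
have {}rel : istar G d (a *: f + b *: xset k H0).
  apply: (istar_trans _ rel); rewrite opprD addrACA subrr addr0 -scalerBr.
  exact: istarZ.
have := degree_istar Gamma_down Gamma_card th_generic z_cycle z_supp (istar_xset rel).
rewrite mulrDr -!scalerAr degreeD !degreeZ degf mulr0 add0r -xsetU;
  last by rewrite disjoint_sym.
rewrite GH0 (degree_xset th_generic z_supp F0d) => /eqP.
rewrite !mulf_eq0 invr_eq0 (negbTE zF0).
rewrite (negbTE (facet_minor_neq0 th_generic F0d)) !orbF => /eqP b0.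
move: nab rel; rewrite b0 eqxx orbF scale0r addr0 => a0 rel.
by rewrite -(scale1r f) -(mulVf a0) -scalerA; apply: istarZ.
Qed.

(** Poincare duality of the star of a face in [Q]: in the top degree it is the
    one-dimensionality of the top cohomology of the link; below, an element
    orthogonal to everything vanishes on all smaller stars, by induction, and
    the local complex is exact. *)
Lemma star_dual G i f : G \in Gamma -> Q G ->
  (forall F, F \in Gamma -> G \subset F -> #|F| = d -> z F != 0) ->
  f \is i.-homog -> (i <= d - #|G|)%N ->
  (forall b, b \is (d - #|G| - i).-homog -> deg (xset k G * (f * b)) = 0) ->
  istar G d f.
Proof.
move: {2}(d - #|G|)%N (erefl (d - #|G|)%N) => e.
elim: e G => [|e IH] G Ge GG QG zG fi ie degf.
  have [F [FG GF Fd]] := Gamma_pure GG.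
  apply: star_dual_top => //; first exact: Q_top.
  - by exists F; split=> //; apply: zG.
  - by have -> : (d - #|G|)%N = i by lia.
  - rewrite -[f]mulr1; apply: degf; have -> : (d - #|G| - i)%N = 0%N by lia.
    exact: dhomog1.
move: ie; rewrite leq_eqVlt => /orP [/eqP ie|ie].
  have [F [FG GF Fd]] := Gamma_pure GG.
  apply: star_dual_top => //; first exact: Q_top.
  - by exists F; split=> //; apply: zG.
  - by rewrite -ie.
  - by rewrite -[f]mulr1; apply: degf; rewrite ie subnn dhomog1.
apply: (istar_local Gamma_down GG (i := i)) => //.
  apply: (cech_exact_big Gamma_down Gamma_card th_generic Q_coh) => //.
  - by rewrite (Gamma_card GG) leqnn.
  - move=> K s KG K0 sd.
    apply: (star_regular Gamma_down Gamma_card th_generic Q_up Q_coh) => //.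
      exact: link_faceU.
    by apply: Q_up QG _; apply: subsetUl.
  - by rewrite addn0 neq_ltn ie.
move=> v vG vGG; have cvG : #|v |: G| = #|G|.+1 by rewrite cardsU1 vG.
have cvGe : (d - #|v |: G|)%N = e by rewrite cvG; lia.
apply: (IH _ cvGe) => //.
- by apply: Q_up QG _; apply: subsetUr.
- by move=> F FG vF; apply: zG => //; apply: subset_trans vF; apply: subsetUr.
- by rewrite cvG; lia.
- move=> b bh; rewrite xsetU1 // -mulrA mulrCA [_ * (f * b)]mulrCA.
  apply: degf; have -> : (d - #|G| - i = 1 + (d - #|v |: G| - i))%N by rewrite cvG; lia.
  by apply: dhomogM => //; rewrite dhomogX; apply/eqP/mdeg1.
Qed.

End Duality.

(** * The interior socle *)

Section Ideals.
Variables (k : fieldType) (N : nat).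
Local Notation S := {mpoly k[N]}.
Implicit Types (f g : S) (s : seq S).

Lemma ideal_gen0 s : ideal_gen s 0.
Proof. by exists (fun _ => 0); rewrite big1 // => i _; rewrite mul0r. Qed.

Lemma ideal_genD s f g : ideal_gen s f -> ideal_gen s g -> ideal_gen s (f + g).
Proof.
case=> c -> [c' ->]; exists (fun i => c i + c' i).
by rewrite -big_split; apply: eq_bigr => i _; rewrite mulrDl.
Qed.

Lemma ideal_genM s f g : ideal_gen s f -> ideal_gen s (g * f).
Proof.
case=> c ->; exists (fun i => g * c i); rewrite mulr_sumr.
by apply: eq_bigr => i _; rewrite mulrA.
Qed.

Lemma ideal_gen_sum s (T : Type) (r : seq T) (P : pred T) (F : T -> S) :
  (forall i, P i -> ideal_gen s (F i)) -> ideal_gen s (\sum_(i <- r | P i) F i).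
Proof. by move=> hF; apply: big_ind => //; [apply: ideal_gen0 | apply: ideal_genD]. Qed.

Lemma ideal_gen_mem s f : f \in s -> ideal_gen s f.
Proof.
move=> fs; have fi : (index f s < size s)%N by rewrite index_mem.
exists (fun i => (i == Ordinal fi)%:R).
rewrite (bigD1 (Ordinal fi)) //= eqxx mul1r nth_index // big1 ?addr0 //.
by move=> i /negbTE ->; rewrite mul0r.
Qed.

Lemma ideal_gen_ind s (P : S -> Prop) : P 0 -> (forall f g, P f -> P g -> P (f + g)) ->
  (forall f g, f \in s -> P (g * f)) -> forall f, ideal_gen s f -> P f.
Proof.
move=> P0 PD PM f [c ->]; apply: big_ind => // i _; apply: PM; exact: mem_nth.
Qed.

Variables (d : nat) (Gamma : {set {set 'I_N}}) (Theta : 'M[k]_(d, N)).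
Local Notation th := (nat_rows Theta).

Lemma linear_formE (i : 'I_d) : linear_form Theta i = lin (th i).
Proof. by rewrite nat_rowsE. Qed.

Lemma face_idealP f : downward Gamma ->
  face_ideal Gamma Theta f <-> istar Gamma th set0 d f.
Proof.
move=> Gamma_down; split.
  apply: ideal_gen_ind => [|g h|g h].
  - exact: istar0.
  - exact: istarD.
  - rewrite mem_cat => /orP [] /mapP [].
      move=> F; rewrite mem_enum inE => FN ->.
      apply: istarM => //; apply: nonstar_istar.
      rewrite -/(xset k F) xsetE; apply: nonstarX.
      by rewrite msupport_mesym1 setU0.
    by move=> i _ ->; rewrite linear_formE; apply: istarM => //; apply: istar_row.
case=> h hf; set q := \sum_(_ < _) _ in hf.
rewrite -(subrK q f); apply: ideal_genD; last first.
  apply: ideal_gen_sum => i _; apply: ideal_genM; apply: ideal_gen_mem.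
  by rewrite mem_cat -linear_formE map_f ?orbT // mem_enum.
rewrite (mpolyE (f - q)) big_seq; apply: ideal_gen_sum => m mf.
have mG : msupport m \notin Gamma.
  by apply: contraL mf => mG; rewrite mcoeff_msupp negbK; apply/eqP/hf; rewrite setU0.
have -> : m = ((m - mesym1 (msupport m)) + mesym1 (msupport m))%MM.
  rewrite submK //; apply/mnm_lepP => v; rewrite mnmE inE.
  by case: (m v).
rewrite mpolyXD -xsetE scalerAl; apply: ideal_genM; apply: ideal_gen_mem.
by rewrite mem_cat; apply/orP; left; apply: map_f; rewrite mem_enum inE.
Qed.

Lemma max_ideal_var u g : max_ideal ('X_u * g : S).
Proof.
by rewrite mulrC; apply/ideal_genM/ideal_gen_mem/map_f; rewrite mem_enum.
Qed.

Lemma socleP (I : S -> Prop) f : I 0 -> (forall g h, I g -> I h -> I (g + h)) ->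
  (forall g h, I h -> I (g * h)) ->
  (forall u, I ('X_u * f)) -> socle I f.
Proof.
move=> I0 ID IM If; apply: (ideal_gen_ind (P := fun g => I (g * f)))
  => [|h1 h2|h1 h2 /mapP [u _ ->]].
- by rewrite mul0r.
- by rewrite mulrDl; apply: ID.
- by rewrite -mulrA; apply: IM.
Qed.

End Ideals.

Section Gorenstein.
Variables (k : fieldType) (N d' : nat) (Gamma : {set {set 'I_N}}).
Local Notation d := d'.+1.
Variables (Theta : 'M[k]_(d, N)) (Q : pred {set 'I_N}) (z : {set 'I_N} -> k) (v0 : 'I_N).
Local Notation th := (nat_rows Theta).
Local Notation S := {mpoly k[N]}.
Local Notation lk := (link Gamma).
Local Notation I := (face_ideal Gamma Theta).
Local Notation star0 := (istar Gamma th set0 d).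
Local Notation deg := (degree d' th z).
Implicit Types (m : 'X_{1..N}) (F G H K : {set 'I_N}) (f g : S).

Hypothesis Gamma_set0 : set0 \in Gamma.
Hypothesis Gamma_down : downward Gamma.
Hypothesis Gamma_card : forall F, F \in Gamma -> (#|F| <= d)%N.
Hypothesis Gamma_pure : forall G, G \in Gamma ->
  exists F, [/\ F \in Gamma, G \subset F & #|F| = d].
Hypothesis th_generic : generic_rows d th.
Hypothesis Q_up : forall G H, Q G -> G \subset H -> Q H.
Hypothesis Q_coh : forall G, G \in Gamma -> Q G ->
  forall j, j != (d - #|G|)%N -> coh_zero k (lk G) j.
Hypothesis Q_top : forall G, G \in Gamma -> Q G -> coh_le1 k (lk G) (d - #|G|).
Hypothesis Gamma_top : coh_le1 k Gamma d.
Hypothesis z_cycle : forall g : {set 'I_N} -> k, \sum_F z F * cob g F = 0.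
Hypothesis z_supp : forall F, z F != 0 -> F \in Gamma /\ #|F| = d.
Hypothesis z_facet : exists F, z F != 0.
Hypothesis z_Q : forall F, F \in Gamma -> Q F -> #|F| = d -> z F != 0.
Hypothesis Q_vertex : forall v, v != v0 -> Q [set v].

Let IP f : I f <-> star0 f := face_idealP Theta f Gamma_down.

Lemma face_ideal_finite_dim : finite_dim_quotient I.
Proof.
pose spanned f := exists c : {set 'I_N} -> k, star0 (f - \sum_H c H *: xset k H).
have span f : spanned f.
  rewrite (pihomog_partitionE (leqnn (msize f))).
  apply: (big_ind spanned) => [|g h|i _].
  - exists (fun _ => 0); rewrite big1 ?subr0 => [|H _]; first exact: istar0.
    exact: scale0r.
  - case=> c gc [c' hc]; exists (fun H => c H + c' H).
    under eq_bigr => H _ do rewrite scalerDl.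
    by rewrite big_split /= opprD addrACA; apply: istarD.
  - have [c fc] := straighten_homog Gamma_down Gamma_card th_generic (G := set0)
      (leqnn d) (or_intror erefl) (pihomogP [measure of mdeg] i f).
    exists (fun H => if (H \in lk set0) && (#|H| == i) then c H else 0).
    move: fc; rewrite big_mkcond /=; congr (star0 (_ - _)).
    by apply: eq_bigr => H _; case: ifP; rewrite ?scale0r.
pose e := index_enum {set 'I_N}; pose s := [seq xset k H | H <- e].
exists s => f; have [c fc] := span f.
exists (fun i => c (nth set0 e i)); apply/IP.
move: fc; congr (star0 (_ - _)).
rewrite (big_nth set0) -(size_map (@xset k N)) -/s big_mkord.
apply: eq_bigr => i _; congr (_ *: _).
have ie : (i < size e)%N by rewrite -(size_map (@xset k N)) ltn_ord.
by rewrite (nth_map set0 0 (@xset k N) ie).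
Qed.

Lemma degree_homog i f : f \is i.-homog -> i != d -> deg f = 0.
Proof.
move=> fi nid; rewrite /degree (pihomog_ne0 nid fi).
by rewrite -(scale0r (0 : S)) facet_sumZ mul0r.
Qed.

Lemma degree0 : deg 0 = 0.
Proof. by rewrite -(scale0r (0 : S)) degreeZ mul0r. Qed.

Lemma face_ideal_degree f : I f -> deg f = 0.
Proof. by move/IP/(degree_istar Gamma_down Gamma_card th_generic z_cycle z_supp). Qed.

Lemma facet_degree_neq0 F : z F != 0 -> deg (xset k F) != 0.
Proof.
move=> zF; have [FG Fd] := z_supp zF.
rewrite (degree_xset th_generic z_supp Fd) mulf_neq0 // invr_eq0.
exact: facet_minor_neq0.
Qed.

Lemma face_ideal_above i f : f \is i.-homog -> (d < i)%N -> I f.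
Proof.
move=> fi di; apply/IP; apply: (istar_above Gamma_down Gamma_card th_generic) fi => //.
by rewrite cards0 addn0.
Qed.

Lemma face_ideal_top_degree e : top_degree I e <-> e = d.
Proof.
have dtop : top_degree I d.
  split=> [|j [f [fj fI]]]; last first.
    by rewrite leqNgt; apply/negP => /(face_ideal_above fj).
  have [F zF] := z_facet; exists (xset k F); split.
    by rewrite -(z_supp zF).2 xset_homog.
  by move/face_ideal_degree/eqP; rewrite (negbTE (facet_degree_neq0 zF)).
split=> [[e1 e2]|->//]; apply/eqP; rewrite eqn_leq dtop.2 // e2 //; exact: dtop.1.
Qed.

Lemma interior_socle_sub f : I f -> interior_socle I f.
Proof.
move=> fI; exists d; split; first exact/face_ideal_top_degree.
exists (fun _ => 0); split=> [i|].
  by split=> [|g _]; [exact: dhomog0 | rewrite mulr0; apply/IP/istar0].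
by rewrite big1 // subr0.
Qed.

Lemma interior_socle_degree f : interior_socle I f -> deg f = 0.
Proof.
case=> e [/face_ideal_top_degree -> [g [gP /face_ideal_degree]]].
rewrite -scaleN1r degreeD degreeZ.
rewrite (big_morph _ (degreeD d' th z) degree0) big1 ?mulr0 ?addr0 // => i _.
by apply: (@degree_homog i); [case: (gP i) | rewrite neq_ltn ltn_ord].
Qed.

Lemma row0_neq0 u : th 0%N u != 0.
Proof.
have := th_generic (F := [set u]); rewrite cards1 /= => /(_ isT).
rewrite /cobd big_set1 setDv sgn_set1 ltnn mul1r.
by apply: contraNneq => ->; rewrite scale0r.
Qed.

(** The variable of the exceptional vertex is a combination of the others
    modulo the first linear form. *)
Lemma face_ideal_socle f : (forall u, u != v0 -> star0 ('X_u * f)) -> socle I f.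
Proof.
move=> fu; apply: socleP => [|g h /IP gI /IP hI|g h /IP hI|u].
- exact/IP/istar0.
- exact/IP/istarD.
- by apply/IP/istarM.
have [->|/fu uI] := eqVneq u v0; last exact/IP.
apply/IP.
have -> : 'X_v0 * f = (th 0%N v0)^-1 *:
    (f * lin (th 0%N) - \sum_(u | u != v0) th 0%N u *: ('X_u * f)).
  rewrite /lin (bigD1 v0) //= mulrDr mulr_sumr.
  rewrite [X in _ + X - _](eq_bigr (fun u => th 0%N u *: ('X_u * f))) => [|v _].
    by rewrite addrK -scalerAr scalerA mulVf ?row0_neq0 // scale1r mulrC.
  by rewrite -scalerAr mulrC.
apply: istarZ => //; apply: istarB => //.
  by apply: istarM => //; apply: istar_row.
by apply: istar_sum => // v /fu; apply: istarZ.
Qed.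

Lemma interior_socle_gorenstein : gorenstein (interior_socle I).
Proof.
split.
  have [s sP] := face_ideal_finite_dim.
  by exists s => f; have [c fc] := sP f; exists c; apply: interior_socle_sub.
have [F zF] := z_facet; have [FG Fd] := z_supp zF.
have sF := facet_degree_neq0 zF.
exists (xset k F); split.
- have soc : socle I (xset k F).
    apply: face_ideal_socle => u _; apply/IP.
    apply: (@face_ideal_above d.+1) => //.
    rewrite -add1n; apply: dhomogM; last by rewrite -Fd xset_homog.
    by rewrite dhomogX; apply/eqP/mdeg1.
  by move=> g /soc; apply: interior_socle_sub.
- by move/interior_socle_degree/eqP; rewrite (negbTE sF).
move=> f fsoc; pose c := deg f / deg (xset k F); exists c.
exists d; split; first exact/face_ideal_top_degree.
exists (fun i => pihomog mdeg i f); split.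
  move=> i; split; first exact: pihomogP.
  apply: face_ideal_socle => u uv0.
  have [uG|uG] := boolP ([set u] \in Gamma); last first.
    apply: istarMr => //; apply: nonstar_istar; apply: nonstarX.
    by rewrite msupportU setU0.
  apply: istar_var; rewrite setU0.
  have id := ltn_ord i.
  apply: (star_dual Gamma_down Gamma_card Gamma_pure th_generic Q_up Q_coh Q_top
    z_cycle z_supp uG (Q_vertex uv0) _ (pihomogP [measure of mdeg] i f)).
  - by move=> F1 F1G uF1; apply: z_Q => //; apply: Q_up (Q_vertex uv0) uF1.
  - by rewrite cards1; lia.
  move=> b bh; have := interior_socle_degree (fsoc _ (max_ideal_var u b)).
  rewrite /xset big_set1 => <-; rewrite -[LHS]degree_pihomog -[RHS]degree_pihomog.
  congr (deg _).
  have ub : 'X_u * b \is (d - i).-homog.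
    have -> : (d - i = 1 + (d - #|[set u]| - i))%N by rewrite cards1; lia.
    by apply: dhomogM => //; rewrite dhomogX; apply/eqP/mdeg1.
  rewrite mulrCA [in RHS]mulrC.
  have di : d = (i + (d - i))%N by rewrite subnKC // ltnW.
  rewrite {3}di (pihomog_mul _ _ ub) pihomog_dE // {2}di.
  by apply: dhomogM => //; apply: pihomogP.
apply/IP; apply: istar_homog_parts => // j.
have parts : pihomog mdeg j (\sum_(i < d) pihomog mdeg i f) =
    if (j < d)%N then pihomog mdeg j f else 0.
  rewrite raddf_sum /=; case: ltnP => jd.
    rewrite (bigD1 (Ordinal jd)) //= pihomog_id big1 ?addr0 // => i nij.
    by apply: pihomog_ne0 _ (pihomogP _ _ _); rewrite -val_eqE in nij.
  rewrite big1 // => i _; apply: pihomog_ne0 _ (pihomogP _ _ _).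
  by rewrite neq_ltn (leq_trans (ltn_ord i) jd).
rewrite !pihomogB linearZ /= parts.
have xF : xset k F \is d.-homog by rewrite -Fd xset_homog.
have [jd|dj|jd] := ltngtP j d.
- rewrite (pihomog_ne0 _ xF) ?gtn_eqF // scaler0 subr0 subrr; exact: istar0.
- rewrite (pihomog_ne0 _ xF) ?ltn_eqF // scaler0 !subr0; apply/IP.
  exact: face_ideal_above (pihomogP _ _ _) dj.
rewrite subr0 jd [pihomog _ _ (xset _ _)]pihomog_dE //.
apply: (star_dual_top Gamma_down Gamma_card th_generic z_cycle z_supp) => //.
- rewrite cards0 subn0 (_ : lk set0 = Gamma) //.
  by apply/setP => H; rewrite mem_link // set0U -setI_eq0 setI0 eqxx.
- by exists F; rewrite sub0set.
- rewrite cards0 subn0; apply: rpredB; first exact: pihomogP.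
  exact: dhomogZ.
- rewrite xset0 mul1r -scaleNr degreeD degreeZ degree_pihomog /c.
  by rewrite mulNr divfK // subrr.
Qed.

End Gorenstein.

(** * The completion of a manifold with boundary *)

Section PureComplexes.
Variable N : nat.
Implicit Types (X : {set {set 'I_N}}) (F G H : {set 'I_N}).

Lemma pure_facet e X G : pure_complex e X -> G \in X ->
  exists F, [/\ F \in X, G \subset F & #|F| = e].
Proof.
move=> Xp GX; have [F Fmax GF] := @maxset_exists _ [pred G | G \in X] G GX.
by exists F; split=> //; [have := maxsetp Fmax | apply: Xp].
Qed.

Lemma pure_card e X G : pure_complex e X -> G \in X -> (#|G| <= e)%N.
Proof. by move=> Xp /(pure_facet Xp) [F [_ GF <-]]; apply: subset_leq_card. Qed.

Lemma link_down X G : downward X -> downward (link X G).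
Proof.
move=> Xc H K; rewrite !mem_link // => /andP [dHG GH] KH.
by rewrite (disjointWl KH dHG) (Xc _ _ GH) // setUS.
Qed.

End PureComplexes.

Section Completion.
Variables (k : fieldType) (n d' : nat) (Delta : {set {set 'I_n}}).
Local Notation d := d'.+1.
Local Notation bd := (boundary_complex k Delta).
Local Notation Gamma := (completion k Delta).
Implicit Types (F G H : {set 'I_n}) (E : {set 'I_n.+1}).

Hypothesis Delta_manifold : homology_manifold_with_boundary k d Delta.

Let Delta_set0 : set0 \in Delta. Proof. by case: Delta_manifold => -[]. Qed.
Let Delta_down : downward Delta. Proof. by case: Delta_manifold => -[]. Qed.
Let bd_down : downward bd. Proof. by case: Delta_manifold => _ _ _ _ [[]]. Qed.

Lemma boundary_sub : bd \subset Delta.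
Proof.
by apply/subsetP => F; rewrite !inE => /orP [/andP [] //|/eqP ->].
Qed.

Lemma up_completion F : (up F \in Gamma) = (F \in Delta).
Proof.
rewrite inE; apply/orP/idP => [[] /imsetP [G GD]|FD].
- by move/up_inj ->.
- by move/setP/(_ ord0); rewrite ord0_up ord0_upc.
- by left; apply: imset_f.
Qed.

Lemma upc_completion F : (upc F \in Gamma) = (F \in bd).
Proof.
rewrite inE; apply/orP/idP => [[] /imsetP [G GD]|FD].
- by move/setP/(_ ord0); rewrite ord0_up ord0_upc.
- by move/upc_inj ->.
- by right; apply: imset_f.
Qed.

Lemma subset_down E E' : E \subset E' -> down E \subset down E'.
Proof. exact: preimsetS. Qed.

Lemma completion_down : downward Gamma.
Proof.
elim/up_upc_ind => F; elim/up_upc_ind => G;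
  rewrite ?up_completion ?upc_completion => FG GF; have := subset_down GF;
  rewrite ?upK ?upcK.
- exact: Delta_down.
- by have := subsetP GF ord0; rewrite ord0_upc ord0_up => /(_ isT).
- by move=> GF'; apply: (subsetP boundary_sub); apply: bd_down GF'.
- exact: bd_down.
Qed.

Let Delta_pure : pure_complex d Delta. Proof. by case: Delta_manifold. Qed.
Let bd_pure : pure_complex d' bd. Proof. by case: Delta_manifold => _ _ _ _ []. Qed.

Lemma completion_pure E : E \in Gamma ->
  exists E', [/\ E' \in Gamma, E \subset E' & #|E'| = d].
Proof.
elim/up_upc_ind: E => G; rewrite ?up_completion ?upc_completion.
  case/(pure_facet Delta_pure) => F [FD GF Fd]; exists (up F).
  by rewrite up_completion FD card_up Fd imsetS.
case/(pure_facet bd_pure) => F [FD GF Fd]; exists (upc F).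
by rewrite upc_completion FD card_upc Fd setUS // imsetS.
Qed.

Lemma completion_card E : E \in Gamma -> (#|E| <= d)%N.
Proof. by case/completion_pure => F [_ EF <-]; apply: subset_leq_card. Qed.

Lemma disjoint_up F G : [disjoint up F & up G] = [disjoint F & G].
Proof. by rewrite -!setI_eq0 -imsetI ?imset_eq0 // => x y _ _; apply: lift_inj0. Qed.

Lemma disjoint_upc F G : [disjoint upc F & up G] = [disjoint F & G].
Proof.
rewrite -[LHS]setI_eq0 /upc setIUl setU_eq0 !setI_eq0 disjoints1 ord0_up.
exact: disjoint_up.
Qed.

Lemma link_up_up F H : (up H \in link Gamma (up F)) = (H \in link Delta F).
Proof.
rewrite !mem_link // ?disjoint_up -?upU ?up_completion //; exact: completion_down.
Qed.

Lemma link_up_upc F H : (upc H \in link Gamma (up F)) = (H \in link bd F).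
Proof.
rewrite !mem_link ?disjoint_upc //; last exact: completion_down.
by rewrite setUCA -upU upc_completion.
Qed.

Lemma link_upc_up F H : (up H \in link Gamma (upc F)) = (H \in link bd F).
Proof.
rewrite !mem_link // 1?disjoint_sym ?disjoint_upc 1?disjoint_sym; last exact: completion_down.
by rewrite -setUA -upU upc_completion.
Qed.

Lemma link_upc_upc F H : (upc H \in link Gamma (upc F)) = (H \in set0).
Proof.
rewrite [RHS]inE mem_link; last exact: completion_down.
by rewrite -setI_eq0; apply/negbTE; rewrite negb_and; apply/orP; left;
   apply/set0Pn; exists ord0; rewrite inE !ord0_upc.
Qed.

Lemma link_boundary_sub F : link bd F \subset link Delta F.
Proof.
apply/subsetP => H; rewrite !mem_link // => /andP [-> /=].
exact: (subsetP boundary_sub).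
Qed.

Lemma link_outside_boundary F : F \notin bd -> link bd F = set0.
Proof.
move=> Fbd; apply/setP => H; rewrite [RHS]inE mem_link //.
apply/negbTE/nandP; right.
by apply: contra Fbd => FH; apply: bd_down FH _; apply: subsetUl.
Qed.

Lemma coh_zero0 j : coh_zero k (set0 : {set {set 'I_n}}) j.
Proof. by move=> f _; exists f => H; rewrite inE. Qed.

Lemma sphere_coh_zero e (X : {set {set 'I_n}}) j : downward X ->
  sphere_homology k e X -> j != e -> coh_zero k X j.
Proof. by move=> Xc Xe /negbTE je; apply: coh_zero_betti; rewrite // Xe je. Qed.

Lemma sphere_coh_le1 e (X : {set {set 'I_n}}) : downward X ->
  sphere_homology k e X -> coh_le1 k X e.
Proof. by move=> Xc Xe; apply: coh_le1_betti; rewrite // Xe eqxx. Qed.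

Lemma boundary_link_sphere F : F \in bd -> F != set0 ->
  sphere_homology k (d' - #|F|) (link bd F).
Proof. by case: Delta_manifold => _ _ _ _ [_ _]; apply. Qed.

Lemma boundary_link_acyclic F : F \in bd -> F != set0 -> acyclic k (link Delta F).
Proof. by rewrite !inE => /orP [/andP [] //|->]. Qed.

Lemma interior_link_sphere F : F \in Delta -> F \notin bd -> F != set0 ->
  sphere_homology k (d - #|F|) (link Delta F).
Proof.
move=> FD Fbd F0; case: Delta_manifold => _ _ H _ _.
by case: (H F FD F0) => // aF; case/negP: Fbd; rewrite !inE FD aF.
Qed.

(** The faces containing a vertex of the manifold are those whose links in the
    completion have the homology of spheres; the link of the apex is the
    boundary. *)
Definition proper_face E := down E != set0.

Lemma proper_face_sub E E' : proper_face E -> E \subset E' -> proper_face E'.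
Proof.
move=> E0 EE'; apply: contraNneq E0 => E'0.
by rewrite -subset0 -E'0 subset_down.
Qed.

(** Filling the boundary sphere of an acyclic link with a cone gives a link
    with the homology of a sphere. *)
Lemma completion_link_coh_zero E : E \in Gamma -> proper_face E ->
  forall j, j != (d - #|E|)%N -> coh_zero k (link Gamma E) j.
Proof.
elim/up_upc_ind: E => F; rewrite /proper_face ?upK ?upcK => FG F0 j.
  rewrite card_up => jd; rewrite up_completion in FG.
  apply: (coh_zero_cone (link_boundary_sub F) (link_up_up F) (link_up_upc F)).
    have [Fbd|Fbd] := boolP (F \in bd).
      by apply: coh_zero_acyclic; [apply: link_down | apply: boundary_link_acyclic].
    by apply: sphere_coh_zero (interior_link_sphere FG Fbd F0) jd; apply: link_down.
  move=> j' jE; have [Fbd|Fbd] := boolP (F \in bd); last first.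
    by rewrite link_outside_boundary //; apply: coh_zero0.
  apply: sphere_coh_zero (boundary_link_sphere Fbd F0) _; first exact: link_down.
  by move: jd; rewrite jE subSn ?eqSS // (pure_card bd_pure).
rewrite card_upc subSS => jd; rewrite upc_completion in FG.
apply: (coh_zero_cone (sub0set _) (link_upc_up F) (link_upc_upc F)).
  by apply: sphere_coh_zero (boundary_link_sphere FG F0) jd; apply: link_down.
by move=> j' _; apply: coh_zero0.
Qed.

Lemma completion_link_coh_le1 E : E \in Gamma -> proper_face E ->
  coh_le1 k (link Gamma E) (d - #|E|).
Proof.
elim/up_upc_ind: E => F; rewrite /proper_face ?upK ?upcK => FG F0.
  rewrite card_up; rewrite up_completion in FG.
  have [Fbd|Fbd] := boolP (F \in bd).
    rewrite subSn ?(pure_card bd_pure) //.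
    apply: (coh_le1_cone_apex (link_boundary_sub F) (link_up_up F) (link_up_upc F)).
      by apply: coh_zero_acyclic; [apply: link_down | apply: boundary_link_acyclic].
    by apply: sphere_coh_le1 (boundary_link_sphere Fbd F0); apply: link_down.
  apply: (coh_le1_cone_base (link_boundary_sub F) (link_up_up F) (link_up_upc F)).
    by apply: sphere_coh_le1 (interior_link_sphere FG Fbd F0); apply: link_down.
  by move=> j' _; rewrite link_outside_boundary //; apply: coh_zero0.
rewrite card_upc subSS; rewrite upc_completion in FG.
apply: (coh_le1_cone_base (sub0set _) (link_upc_up F) (link_upc_upc F)).
  by apply: sphere_coh_le1 (boundary_link_sphere FG F0); apply: link_down.
by move=> j' _; apply: coh_zero0.
Qed.

Lemma proper_face_vertex (v : 'I_n.+1) : v != ord0 -> proper_face [set v].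
Proof.
case: (unliftP ord0 v) => [u|] ->; last by rewrite eqxx.
by move=> _; apply/set0Pn; exists u; rewrite !inE.
Qed.

Lemma proper_faceP E : proper_face E -> exists v, lift ord0 v \in E.
Proof. by case/set0Pn => v; rewrite inE; exists v. Qed.

Hypothesis Delta_connected : connected_complex Delta.

(** Two vertices of [Delta] are joined by a path of edges, along which the
    cycle stays nonzero. *)
Lemma completion_cycle_neq0 (z : {set 'I_n.+1} -> k) :
  (forall g, \sum_E z E * cob g E = 0) ->
  (forall E, z E != 0 -> E \in Gamma /\ #|E| = d) -> (exists F, z (up F) != 0) ->
  forall E, E \in Gamma -> proper_face E -> #|E| = d -> z E != 0.
Proof.
move=> z_cycle z_supp [F0 zF0].
pose star := cycle_star_neq0 completion_down completion_card completion_pure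
  proper_face_sub completion_link_coh_zero completion_link_coh_le1 z_cycle z_supp.
pose nz v := exists E, lift ord0 v \in E /\ z E != 0.
have starv v E : nz v -> lift ord0 v \in E -> E \in Gamma -> #|E| = d -> z E != 0.
  case=> E' [vE' zE'] vE EG Ed.
  apply: (star [set lift ord0 v] E E') => //; rewrite ?sub1set //.
  by apply: proper_face_vertex; rewrite eq_sym neq_lift.
have edge u v : [set u; v] \in Delta -> nz u -> nz v.
  move=> uvD nu; have : up [set u; v] \in Gamma by rewrite up_completion.
  case/completion_pure => E [EG uvE Ed]; exists E; split.
    by apply: (subsetP uvE); rewrite mem_up !inE eqxx orbT.
  by apply: (starv u) => //; apply: (subsetP uvE); rewrite mem_up !inE eqxx.
have [u uF0] : exists u, u \in F0.
  by apply/card_gt0P; rewrite -card_up (z_supp _ zF0).2.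
have nu : nz u by exists (up F0); rewrite mem_up.
have uD : [set u] \in Delta.
  have := (z_supp _ zF0).1; rewrite up_completion => F0D.
  by apply: Delta_down F0D _; rewrite sub1set.
move=> E EG /proper_faceP [v vE] Ed; apply: (starv v) => //.
have vD : [set v] \in Delta.
  by rewrite -up_completion; apply: completion_down EG _; rewrite up_set1 sub1set.
have /connectP [p pP ->] := Delta_connected uD vD.
elim: p u nu pP {uD uF0} => [|w p IH] u nu //= /andP [uw pw].
by apply: IH pw; apply: edge uw nu.
Qed.

Hypothesis Delta_orientable : orientable k d Delta.

Lemma completion_gorenstein (Theta : 'M[k]_(d, n.+1)) :
  generic_rows d (nat_rows Theta) ->
  is_lsop Gamma Theta /\ gorenstein (interior_socle (face_ideal Gamma Theta)).
Proof.
move=> th_gen.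
have [z [z_cycle z_supp z_facet]] := exists_cycle_cone boundary_sub up_completion
  upc_completion Delta_down bd_down Delta_orientable.
have top : coh_le1 k Gamma d.
  apply: (coh_le1_cone_rel boundary_sub up_completion upc_completion) => //.
    by move=> F; apply: pure_card Delta_pure.
  by move=> F; apply: pure_card bd_pure.
split.
  exact: face_ideal_finite_dim completion_down completion_card th_gen.
apply: (interior_socle_gorenstein _ completion_down completion_card completion_pure
  th_gen proper_face_sub completion_link_coh_zero completion_link_coh_le1 top
  z_cycle z_supp _ _ proper_face_vertex).
- by rewrite -[set0](imset0 (lift ord0)) up_completion.
- by case: z_facet => F zF; exists (up F).
- exact: completion_cycle_neq0.
Qed.

End Completion.

Theorem theorem3p1 (k : fieldType) (n d : nat) (Delta : {set {set 'I_n}})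
    (k_infinite : infinite_field k)
    (Delta_manifold : homology_manifold_with_boundary k d Delta)
    (Delta_connected : connected_complex Delta)
    (Delta_orientable : orientable k d Delta) :
  generic (fun Theta : 'M[k]_(d, n.+1) =>
    is_lsop (completion k Delta) Theta /\
    gorenstein (interior_socle (face_ideal (completion k Delta) Theta))).
Proof.
case: d Delta_manifold Delta_orientable => [[] //|d'] Dm Do.
apply: generic_rows_generic => // Theta.
exact: completion_gorenstein.
Qed.
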